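(* Let $R$ be a relative cellular algebra over a field $\mathbb{K}$ with cell datum $(X,M,C,{}^{\star},E,O,\underline{\varepsilon})$, and assume $|X|<\infty$. Let $\lambda\in X_0$, $\mu\in X$, and let $e\in R$ be a primitive idempotent with $\varepsilon_{\lambda}e=e=e\varepsilon_{\lambda}$ such that $P(\lambda)=Re$. (a) The multiplicity $d_{\mu,\lambda}=[\Delta(\mu):L(\lambda)]$ equals $\dim_{\mathbb{K}}(\Delta(\mu)^{\star}\cdot e)$. (b) If $\mu\in X_0$, then $$[P(\lambda):L(\mu)]=\sum_{\nu\in X,\ \nu\leq_{\lambda}\lambda,\ \nu\leq_{\mu}\mu}[\Delta(\nu):L(\lambda)]\,[\Delta(\nu):L(\mu)].$$ (Written as matrices: $\mathbf{C}=\mathbf{D}^{\mathrm{T}}\mathbf{D}$, where $\mathbf{D}=(d_{\nu,\lambda})_{\nu\in X,\lambda\in X_0}$ is the decomposition matrix and $\mathbf{C}=([P(\lambda):L(\mu)])_{\lambda,\mu\in X_0}$ is the Cartan matrix.)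
   Context: Conventions: $\mathbb{K}$ is any field; algebras and maps are over $\mathbb{K}$; modules are finite-dimensional left modules unless stated otherwise; idempotents are non-zero. $[N:L]$ denotes Jordan–Hölder multiplicity. Relative cellular algebra. An associative algebra $R$ together with a (relative) cell datum $(X,M,C,{}^{\star},E,O,\underline{\varepsilon})$ such that: (a) $X$ is a set, $M=\{M(\lambda)\mid\lambda\in X\}$ is a collection of finite non-empty sets, and $C\colon\coprod_{\lambda\in X}M(\lambda)\times M(\lambda)\to R$ is an injective map whose image is a basis of $R$; write $C(S,T)=C^{\lambda}_{S,T}$ for $S,T\in M(\lambda)$. (b) ${}^{\star}\colon R\to R$ is an anti-involution with $(C^{\lambda}_{S,T})^{\star}=C^{\lambda}_{T,S}$. (c) $E$ is a set of pairwise orthogonal idempotents with $\varepsilon^{\star}=\varepsilon$ for all $\varepsilon\in E$; $O=\{<_{\varepsilon}\mid\varepsilon\in E\}$ is a set of partial orders on $X$; and $\underline{\varepsilon}\colon\coprod_{\lambda\in X}M(\lambda)\to E$, $S\mapsto\varepsilon_S$, is a map such that for all $\lambda\in X$, $S,T\in M(\lambda)$, $\varepsilon\in E$: $\varepsilon R\varepsilon\, C^{\lambda}_{S,T}\subset R(\leq_{\varepsilon}\lambda)$, and $\varepsilon C^{\lambda}_{S,T}=C^{\lambda}_{S,T}$ if $\varepsilon_S=\varepsilon$, $\varepsilon C^{\lambda}_{S,T}=0$ if $\varepsilon_S\neq\varepsilon$. Here $R(\leq_{\varepsilon}\lambda)=\mathbb{K}\{C^{\mu}_{S,T}\mid\mu\in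 X,\mu\leq_{\varepsilon}\lambda,S,T\in M(\mu)\}$, and $R(<_{\varepsilon}\lambda)$ is defined in the same way with $<_{\varepsilon}$. (d) For $\lambda\in X$, $S,T\in M(\lambda)$, $a\in R$: $aC^{\lambda}_{S,T}\in\sum_{S'\in M(\lambda)}r_a(S',S)\,C^{\lambda}_{S',T}+R(<_{\varepsilon_T}\lambda)\varepsilon_T$, with scalars $r_a(S',S)\in\mathbb{K}$ depending only on $a,S,S'$. Cell modules. For $\lambda\in X$ the cell module $\Delta(\lambda)$ has basis $\{m^{\lambda}_S\mid S\in M(\lambda)\}$ and action $a\cdot m^{\lambda}_S=\sum_{S'\in M(\lambda)}r_a(S',S)\,m^{\lambda}_{S'}$. The right module $\Delta(\lambda)^{\star}$ is the same vector space with $x\cdot a=a^{\star}\cdot x$. The bilinear form $\Phi^{\lambda}$ on $\Delta(\lambda)$ is given by $\Phi^{\lambda}(m^{\lambda}_S,m^{\lambda}_T)=r_{C^{\lambda}_{U,S}}(U,T)$ (independent of $U\in M(\lambda)$). Put $\mathrm{rad}(\lambda)=\{x\in\Delta(\lambda)\mid\Phi^{\lambda}(x,y)=0\ \forall y\in\Delta(\lambda)\}$, which is a submodule, $X_0=\{\lambda\in X\mid\Phi^{\lambda}\neq0\}$, and $L(\lambda)=\Delta(\lambda)/\mathrm{rad}(\lambda)$ for $\lambda\in X_0$; when $|X|<\infty$ the $L(\lambda)$, $\lambda\in X_0$, are a complete non-redundant list of simple modules. Projectives. Assume $|X|<\infty$ (then $R$ is finite-dimensional and unital with unit $\sum_{\varepsilon\in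 E}\varepsilon$). For $\lambda\in X_0$, $P(\lambda)$ is the indecomposable projective module with simple head $L(\lambda)$. There are $\varepsilon_{\lambda}\in E$ and a primitive idempotent $e$ with $\varepsilon_{\lambda}e=e=e\varepsilon_{\lambda}$ and $P(\lambda)\cong Re$; fix such an $\varepsilon_{\lambda}$ for each $\lambda\in X_0$ and write $<_{\lambda}$ for $<_{\varepsilon_{\lambda}}$ and $\leq_{\lambda}$ for $\leq_{\varepsilon_{\lambda}}$. *)

(* Defs.v *)
From HB Require Import structures.
From mathcomp Require Import all_boot all_order all_algebra.
From mathcomp Require Import generic_quotient ring_quotient.
From mathcomp Require Import boolp classical_sets.

Set Implicit Arguments.
Unset Strict Implicit.
Unset Printing Implicit Defensive.

Import GRing.Theory.
Local Open Scope ring_scope.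
Local Open Scope quotient_scope.

(* MathComp's [algType] is unital, but a relative cellular algebra need not
   be: that it has a unit when [X] is finite is a consequence of the axioms. *)
Record algebra (K : fieldType) := Algebra {
  alg_car :> lmodType K;
  amul : alg_car -> alg_car -> alg_car;
  amulA : associative amul;
  amulDl : left_distributive amul +%R;
  amulDr : right_distributive amul +%R;
  amulZl : forall (k : K) a b, amul (k *: a) b = k *: amul a b;
  amulZr : forall (k : K) a b, amul a (k *: b) = k *: amul a b }.

Notation "a '**' b" := (amul a b) (at level 40, left associativity).

Definition is_unit (K : fieldType) (R : algebra K) (u : R) : Prop :=
  forall a : R, u ** a = a /\ a ** u = a.

Definition idempotent_elt (K : fieldType) (R : algebra K) (e : R) : Prop :=
  e <> 0 /\ e ** e = e.

Definition primitive_idempotent (K : fieldType) (R : algebra K) (e : R) : Prop :=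
  idempotent_elt e /\
  ~ exists f g : R, [/\ idempotent_elt f, idempotent_elt g,
                        f ** g = 0, g ** f = 0 & e = f + g].

(* [act_unit]: if the algebra happens to have a unit, it acts as the identity. *)
Record lmodule (K : fieldType) (R : algebra K) := LModule {
  mod_car :> lmodType K;
  act : R -> mod_car -> mod_car;
  actDl : forall a b x, act (a + b) x = act a x + act b x;
  actZl : forall (k : K) a x, act (k *: a) x = k *: act a x;
  actDr : forall a x y, act a (x + y) = act a x + act a y;
  actZr : forall (k : K) a x, act a (k *: x) = k *: act a x;
  actM : forall a b x, act (a ** b) x = act a (act b x);
  act_unit : forall u, is_unit u -> forall x, act u x = x }.

Definition equivariant (K : fieldType) (R : algebra K) (N P : lmodule R)
  (f : N -> P) : Prop := forall a x, f (act a x) = act a (f x).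

Definition lmod_iso (K : fieldType) (R : algebra K) (N P : lmodule R) : Prop :=
  exists f : {linear N -> P}, equivariant f /\ bijective f.

Record submodule (K : fieldType) (R : algebra K) (N : lmodule R) := Submodule {
  sm_pred :> {pred N};
  sm_lin : submod_closed sm_pred;
  sm_act : forall a x, x \in sm_pred -> act a x \in sm_pred }.

HB.instance Definition _ (K : fieldType) (R : algebra K) (N : lmodule R)
  (U : submodule N) :=
  GRing.isSubmodClosed.Build K N (sm_pred U) (sm_lin U).

Section SubQuotient.
Variables (K : fieldType) (R : algebra K) (N : lmodule R).

Section Sub.
Variable U : submodule N.

Record sub_car := SubCar { sub_val :> N; sub_valP : sub_val \in U }.
HB.instance Definition _ := [isSub for sub_val].
HB.instance Definition _ := [Choice of sub_car by <:].
HB.instance Definition _ := [SubChoice_isSubLmodule of sub_car by <:].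

Definition sub_act (a : R) (x : sub_car) : sub_car :=
  SubCar (sm_act a (sub_valP x)).

Lemma sub_actDl a b x : sub_act (a + b) x = sub_act a x + sub_act b x.
Proof. by apply/val_inj; rewrite raddfD; apply: actDl. Qed.
Lemma sub_actZl (k : K) a x : sub_act (k *: a) x = k *: sub_act a x.
Proof. by apply/val_inj; rewrite linearZ; apply: actZl. Qed.
Lemma sub_actDr a x y : sub_act a (x + y) = sub_act a x + sub_act a y.
Proof. by apply/val_inj; rewrite raddfD; apply: actDr. Qed.
Lemma sub_actZr (k : K) a x : sub_act a (k *: x) = k *: sub_act a x.
Proof. by apply/val_inj; rewrite linearZ; apply: actZr. Qed.
Lemma sub_actM a b x : sub_act (a ** b) x = sub_act a (sub_act b x).
Proof. by apply/val_inj; apply: actM. Qed.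
Lemma sub_act_unit u : is_unit u -> forall x, sub_act u x = x.
Proof. by move=> hu x; apply/val_inj; apply: act_unit. Qed.

Definition sub : lmodule R :=
  LModule sub_actDl sub_actZl sub_actDr sub_actZr sub_actM sub_act_unit.
End Sub.

Section Quo.
Variable W : submodule N.

Definition quo_car := Quotient.quot (sm_pred W).
HB.instance Definition _ := GRing.Zmodule.on quo_car.
Definition quo_pi (x : N) : quo_car := \pi_(Quotient.quot (sm_pred W)) x.

Lemma quo_piD x y : quo_pi (x + y) = quo_pi x + quo_pi y.
Proof. exact: (raddfD \pi_(Quotient.quot (sm_pred W))). Qed.

Lemma quo_piP x y : reflect (quo_pi x = quo_pi y) (x - y \in sm_pred W).
Proof. by rewrite Quotient.idealrBE; apply: eqP. Qed.

Lemma quo_piK (x : quo_car) : quo_pi (repr x) = x.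
Proof. exact: reprK. Qed.

Definition quo_scale (k : K) (x : quo_car) : quo_car :=
  quo_pi (k *: repr x).

Lemma quo_scale_pi k x : quo_scale k (quo_pi x) = quo_pi (k *: x).
Proof.
apply/quo_piP; rewrite -scalerBr; apply: rpredZ; apply/quo_piP.
exact: quo_piK.
Qed.

Lemma quo_scaleA a b v : quo_scale a (quo_scale b v) = quo_scale (a * b) v.
Proof. by rewrite -[v]quo_piK !quo_scale_pi scalerA. Qed.
Lemma quo_scale1 : left_id 1 quo_scale.
Proof. by move=> v; rewrite -[v]quo_piK quo_scale_pi scale1r. Qed.
Lemma quo_scaleDr : right_distributive quo_scale +%R.
Proof.
move=> a u v; rewrite -[u]quo_piK -[v]quo_piK.
by rewrite -quo_piD !quo_scale_pi -quo_piD scalerDr.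
Qed.
Lemma quo_scaleDl v : {morph quo_scale^~ v : a b / a + b}.
Proof.
by move=> a b /=; rewrite -[v]quo_piK !quo_scale_pi -quo_piD scalerDl.
Qed.

HB.instance Definition _ := GRing.Zmodule_isLmodule.Build K quo_car
  quo_scaleA quo_scale1 quo_scaleDr quo_scaleDl.

Definition quo_act (a : R) (x : quo_car) : quo_car :=
  quo_pi (act a (repr x)).

Lemma quo_piZ (k : K) x : quo_pi (k *: x) = k *: quo_pi x.
Proof. by rewrite -[LHS]quo_scale_pi. Qed.

Lemma quo_act_pi a x : quo_act a (quo_pi x) = quo_pi (act a x).
Proof.
apply/quo_piP.
have -> : act a (repr (quo_pi x)) - act a x =
          act a (repr (quo_pi x) - x).
  by rewrite actDr -[- x]scaleN1r actZr scaleN1r.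
by apply: sm_act; apply/quo_piP; apply: quo_piK.
Qed.

Lemma quo_actDl a b x : quo_act (a + b) x = quo_act a x + quo_act b x.
Proof. by rewrite -[x]quo_piK !quo_act_pi -quo_piD actDl. Qed.
Lemma quo_actZl (k : K) a x : quo_act (k *: a) x = k *: quo_act a x.
Proof. by rewrite -[x]quo_piK !quo_act_pi -quo_piZ actZl. Qed.
Lemma quo_actDr a x y : quo_act a (x + y) = quo_act a x + quo_act a y.
Proof.
rewrite -[x]quo_piK -[y]quo_piK -quo_piD !quo_act_pi -quo_piD.
by rewrite actDr.
Qed.
Lemma quo_actZr (k : K) a x : quo_act a (k *: x) = k *: quo_act a x.
Proof. by rewrite -[x]quo_piK -quo_piZ !quo_act_pi -quo_piZ actZr. Qed.
Lemma quo_actM a b x : quo_act (a ** b) x = quo_act a (quo_act b x).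
Proof. by rewrite -[x]quo_piK !quo_act_pi actM. Qed.
Lemma quo_act_unit u : is_unit u -> forall x, quo_act u x = x.
Proof. by move=> hu x; rewrite -[x]quo_piK quo_act_pi act_unit. Qed.

Definition quo : lmodule R :=
  LModule quo_actDl quo_actZl quo_actDr quo_actZr quo_actM quo_act_unit.
End Quo.

End SubQuotient.

Section Modules.
Variables (K : fieldType) (R : algebra K).
Implicit Types (N P L : lmodule R).

Lemma sm_pull_lin N (U W : submodule N) :
  submod_closed [pred x : sub U | sub_val x \in sm_pred W].
Proof.
split=> [|k x y]; rewrite !inE; first exact: (rpred0 (sm_pred W)).
by move=> hx hy; apply: (@rpredD _ (sm_pred W)) => //; apply: rpredZ.
Qed.
Lemma sm_pull_act N (U W : submodule N) a x :
  x \in [pred x : sub U | sub_val x \in sm_pred W] ->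
  act a x \in [pred x : sub U | sub_val x \in sm_pred W].
Proof. by rewrite !inE => /(sm_act a). Qed.

Definition sm_pull N (U W : submodule N) : submodule (sub U) :=
  Submodule (sm_pull_lin U W) (@sm_pull_act N U W).

(* The subquotient U / (U :&: W); it is U / W when W is contained in U. *)
Definition subquo N (U W : submodule N) : lmodule R := quo (sm_pull U W).

Definition sm_le N (U W : submodule N) : Prop := {subset U <= W}.
Definition sm_zero N (U : submodule N) : Prop := forall x, x \in U -> x = 0.
Definition sm_full N (U : submodule N) : Prop := forall x, x \in U.

Definition nonzero_mod N : Prop := exists x : N, x <> 0.

Definition simple_mod N : Prop :=
  nonzero_mod N /\ forall U : submodule N, sm_zero U \/ sm_full U.

Record comp_series N := CompSeries {
  cs_len : nat;
  cs_sub : nat -> submodule N;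
  cs_bot : sm_zero (cs_sub 0%N);
  cs_top : sm_full (cs_sub cs_len);
  cs_le : forall i, (i < cs_len)%N -> sm_le (cs_sub i) (cs_sub i.+1);
  cs_simple : forall i, (i < cs_len)%N ->
    simple_mod (subquo (cs_sub i.+1) (cs_sub i)) }.

Definition cs_mult N (s : comp_series N) L : nat :=
  #|[set i : 'I_(cs_len s)
      | `[< lmod_iso (subquo (cs_sub s i.+1) (cs_sub s i)) L >]]|.

(* [N : L], read off some composition series of N; by the Jordan-Hoelder
   theorem the value does not depend on it.  The default 0 is only reached
   when N has no composition series. *)
Definition JHmult N L : nat :=
  xget 0%N [set n | exists s : comp_series N, cs_mult s L = n].

Definition projective P : Prop :=
  forall (A B : lmodule R) (g : {linear A -> B}) (f : {linear P -> B}),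
    equivariant g -> equivariant f -> (forall b, exists a, g a = b) ->
  exists2 h : {linear P -> A}, equivariant h & forall x, g (h x) = f x.

Definition indecomposable N : Prop :=
  nonzero_mod N /\
  forall U W : submodule N,
    (forall x, x \in U -> x \in W -> x = 0) ->
    (forall x, exists2 u, u \in U & exists2 w, w \in W & x = u + w) ->
  sm_zero U \/ sm_zero W.

Definition maximal_sm N (U : submodule N) : Prop :=
  ~ sm_full U /\
  forall W : submodule N, sm_le U W -> sm_full W \/ sm_le W U.

Definition radical_pred N : {pred N} :=
  [pred x | `[< forall U : submodule N, maximal_sm U -> x \in U >]].

Arguments radical_pred N : clear implicits.

Lemma radicalP N x :
  reflect (forall U : submodule N, maximal_sm U -> x \in U) (x \in radical_pred N).
Proof. exact: asboolP. Qed.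

Lemma radical_lin N : submod_closed (radical_pred N).
Proof.
split=> [|k x y]; first by apply/radicalP => U _; apply: (rpred0 (sm_pred U)).
move=> /radicalP hx /radicalP hy; apply/radicalP => U mU.
by apply: (@rpredD _ (sm_pred U)); [apply: rpredZ; apply: hx | apply: hy].
Qed.
Lemma radical_act N a x : x \in radical_pred N -> act a x \in radical_pred N.
Proof. by move=> /radicalP hx; apply/radicalP => U mU; apply/sm_act/hx. Qed.

Definition radical N : submodule N := Submodule (@radical_lin N) (@radical_act N).
Definition head N : lmodule R := quo (radical N).

Definition is_proj_indec_with_head P L : Prop :=
  [/\ projective P, indecomposable P & lmod_iso (head P) L].

Definition regular : lmodule R :=
  @LModule K R R (@amul K R) (fun a b x => @amulDl K R a b x) (@amulZl K R)
    (fun a x y => @amulDr K R a x y) (fun k a x => @amulZr K R k a x)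
    (fun a b x => esym (@amulA K R a b x)) (fun u hu x => (hu x).1).

Definition left_ideal_pred (e : R) : {pred regular} :=
  [pred x : R | `[< exists r : R, x = r ** e >]].

Lemma left_idealP e (x : R) :
  reflect (exists r : R, x = r ** e) (x \in left_ideal_pred e).
Proof. exact: asboolP. Qed.

Lemma left_ideal_lin e : submod_closed (left_ideal_pred e).
Proof.
split=> [|k x y].
  apply/left_idealP; exists 0.
  by have := amulZl 0 (0 : R) e; rewrite !scale0r.
move=> /left_idealP [r ->] /left_idealP [s ->]; apply/left_idealP.
by exists (k *: r + s); rewrite amulDl amulZl.
Qed.
Lemma left_ideal_act e a (x : regular) :
  x \in left_ideal_pred e -> act a x \in left_ideal_pred e.
Proof.
move=> /left_idealP [r ->]; apply/left_idealP; exists (a ** r).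
exact: amulA.
Qed.

Definition Rmod (e : R) : lmodule R :=
  sub (Submodule (@left_ideal_lin e) (@left_ideal_act e)).

End Modules.

Local Open Scope classical_set_scope.

Section Spans.
Variables (K : fieldType) (V : lmodType K).

Definition span_set (B : set V) : set V :=
  [set v | exists (s : seq V) (c : V -> K),
     (forall x, x \in s -> B x) /\ v = \sum_(x <- s) c x *: x].

Definition lin_indep_set (B : set V) : Prop :=
  forall (s : seq V) (c : V -> K), uniq s -> (forall x, x \in s -> B x) ->
    \sum_(x <- s) c x *: x = 0 -> forall x, x \in s -> c x = 0.

Definition is_basis (B : set V) : Prop :=
  lin_indep_set B /\ forall v, span_set B v.

End Spans.

Section CellMap.
Variables (K : fieldType) (R : algebra K) (X : eqType) (M : X -> finType).
Variable C : forall l : X, M l -> M l -> R.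

Definition cell_map (p : {l : X & (M l * M l)%type}) : R :=
  C (projT2 p).1 (projT2 p).2.

Definition cell_span (P : pred X) : set R :=
  span_set [set x | exists l (S T : M l), P l /\ x = C S T].

End CellMap.

(* The set of idempotents is given as a family [eps] indexed by [E]; being
   non-zero and pairwise orthogonal, it is automatically injective.  The
   scalars [cd_r l a S' S] = r_a(S',S) are determined by the other data since
   the C^l_{S,T} form a basis. *)
Record cell_datum (K : fieldType) (R : algebra K) (X : eqType) := CellDatum {
  cd_M : X -> finType;
  cd_C : forall l : X, cd_M l -> cd_M l -> R;
  cd_star : R -> R;
  cd_E : Type;
  cd_eps : cd_E -> R;
  cd_lt : cd_E -> rel X;
  cd_epsm : forall l : X, cd_M l -> cd_E;
  cd_r : forall l : X, R -> cd_M l -> cd_M l -> K;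
  cd_M_nonempty : forall l, (0 < #|cd_M l|)%N;
  cd_C_inj : injective (cell_map cd_C);
  cd_C_basis : is_basis (range (cell_map cd_C));
  cd_star_lin : forall (k : K) x y, cd_star (k *: x + y) = k *: cd_star x + cd_star y;
  cd_starM : forall x y, cd_star (x ** y) = cd_star y ** cd_star x;
  cd_starK : involutive cd_star;
  cd_starC : forall l (S T : cd_M l), cd_star (cd_C S T) = cd_C T S;
  cd_eps_idem : forall d, idempotent_elt (cd_eps d);
  cd_eps_orth : forall d d', d <> d' -> cd_eps d ** cd_eps d' = 0;
  cd_eps_star : forall d, cd_star (cd_eps d) = cd_eps d;
  cd_lt_irr : forall d, irreflexive (cd_lt d);
  cd_lt_trans : forall d, transitive (cd_lt d);
  cd_eCe : forall d (a : R) l (S T : cd_M l),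
    cell_span cd_C (fun m => (m == l) || cd_lt d m l)
      (cd_eps d ** a ** cd_eps d ** cd_C S T);
  cd_eC1 : forall d l (S T : cd_M l),
    cd_epsm S = d -> cd_eps d ** cd_C S T = cd_C S T;
  cd_eC0 : forall d l (S T : cd_M l),
    cd_epsm S <> d -> cd_eps d ** cd_C S T = 0;
  cd_mulC : forall l (S T : cd_M l) (a : R),
    exists2 y : R, cell_span cd_C (fun m => cd_lt (cd_epsm T) m l) y &
      a ** cd_C S T =
        \sum_(S' : cd_M l) cd_r a S' S *: cd_C S' T + y ** cd_eps (cd_epsm T) }.

Arguments cd_C {K R X} c {l}.
Arguments cd_star {K R X}.
Arguments cd_eps {K R X}.
Arguments cd_lt {K R X}.
Arguments cd_epsm {K R X} c {l}.
Arguments cd_r {K R X} c {l}.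

Section Coordinates.
Variables (K : fieldType) (V : lmodType K).
Implicit Types B : set V.

Lemma span_ind B (P : V -> Prop) : P 0 ->
  (forall (k : K) x y, P x -> P y -> P (k *: x + y)) ->
  (forall x, B x -> P x) -> forall v, span_set B v -> P v.
Proof.
move=> P0 PD PB v [s [c [sB ->]]]; elim: s sB => [|x s IH] sB.
  by rewrite big_nil.
rewrite big_cons; apply: PD; first by apply/PB/sB; rewrite mem_head.
by apply: IH => y ys; apply: sB; rewrite inE ys orbT.
Qed.

Definition is_coords B (s : seq V) (c : V -> K) (v : V) : Prop :=
  [/\ uniq s, forall x, x \in s -> B x, forall x, x \notin s -> c x = 0 &
      v = \sum_(x <- s) c x *: x].

Lemma is_coords_ext B s c v t : is_coords B s c v -> uniq t ->
  {subset s <= t} -> v = \sum_(x <- t) c x *: x.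
Proof.
move=> [us sB c0 ->] ut st.
rewrite [RHS](bigID (mem s)) /= [X in _ + X]big1; last first.
  by move=> x xs; rewrite c0 // scale0r.
rewrite addr0 -[RHS]big_filter; apply: perm_big; apply: uniq_perm => //.
  exact: filter_uniq.
by move=> x; rewrite mem_filter; apply/idP/andP => [xs|[]//]; split => //; apply: st.
Qed.

Lemma is_coords_lin B s c v t d w (k : K) :
  is_coords B s c v -> is_coords B t d w ->
  is_coords B (undup (s ++ t)) (fun x => k * c x + d x) (k *: v + w).
Proof.
move=> cv dw; have [us sB c0 _] := cv; have [ut tB d0 _] := dw; split.
- exact: undup_uniq.
- by move=> x; rewrite mem_undup mem_cat => /orP[/sB|/tB].
- move=> x; rewrite mem_undup mem_cat negb_or => /andP[xs xt].
  by rewrite c0 // d0 // mulr0 addr0.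
rewrite (is_coords_ext cv (undup_uniq (s ++ t))); last first.
  by move=> x xs; rewrite mem_undup mem_cat xs.
rewrite (is_coords_ext dw (undup_uniq (s ++ t))); last first.
  by move=> x xs; rewrite mem_undup mem_cat xs orbT.
rewrite scaler_sumr -big_split /=; apply: eq_bigr => x _.
by rewrite scalerDl scalerA.
Qed.

Lemma is_coords_mem B x : B x -> is_coords B [:: x] (fun y => (y == x)%:R) x.
Proof.
move=> Bx; split => //.
- by move=> y; rewrite inE => /eqP ->.
- by move=> y; rewrite inE => /negPf ->.
by rewrite big_seq1 eqxx scale1r.
Qed.

Lemma is_coords0 B : is_coords B [::] (fun=> 0) 0.
Proof. by split => //; rewrite big_nil. Qed.

Lemma is_coords_exists B v : is_basis B -> exists sc, is_coords B sc.1 sc.2 v.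
Proof.
case=> _ /(_ v).
apply: (@span_ind B (fun w => exists sc, is_coords B sc.1 sc.2 w)).
- by exists ([::], fun=> 0); apply: is_coords0.
- move=> k x y [[s c] hx] [[t d] hy].
  by exists (undup (s ++ t), fun z => k * c z + d z); apply: is_coords_lin.
- by move=> x Bx; exists ([:: x], fun z => (z == x)%:R); apply: is_coords_mem.
Qed.

Lemma is_coords_uniq B s c t d v : is_basis B ->
  is_coords B s c v -> is_coords B t d v -> c = d.
Proof.
move=> [indB _] hc hd; have := is_coords_lin (-1) hc hd.
case=> uu sB c0; rewrite scaleN1r addNr => /esym/(indB _ _ uu sB) h.
apply/funext => x; apply/eqP; rewrite eq_sym -subr_eq0 addrC -mulN1r.
have [/h ->//|/c0 ->//] := boolP (x \in undup (s ++ t)).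
Qed.

Definition coords B (hB : is_basis B) (v : V) : V -> K :=
  (projT1 (cid (is_coords_exists v hB))).2.

Lemma coordsP B (hB : is_basis B) v :
  exists s, is_coords B s (coords hB v) v.
Proof. by rewrite /coords; case: cid => -[s c] /= h; exists s. Qed.

Lemma coords_eq B (hB : is_basis B) s c v :
  is_coords B s c v -> coords hB v = c.
Proof. by move=> h; have [t h'] := coordsP hB v; apply: is_coords_uniq h' h. Qed.

Lemma coords_lin B (hB : is_basis B) (k : K) v w x :
  coords hB (k *: v + w) x = k * coords hB v x + coords hB w x.
Proof.
have [s hs] := coordsP hB v; have [t ht] := coordsP hB w.
by rewrite (coords_eq hB (is_coords_lin k hs ht)).
Qed.

Lemma coords_mem B (hB : is_basis B) x y :
  B x -> coords hB x y = (y == x)%:R.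
Proof. by move=> Bx; rewrite (coords_eq hB (is_coords_mem Bx)). Qed.

End Coordinates.

Section CellTheory.
Variables (K : fieldType) (R : algebra K) (X : eqType) (D : cell_datum R X).

Local Notation M := (cd_M D).
Local Notation C := (cd_C D).
Local Notation r := (cd_r D).
Local Notation "a ^!" := (cd_star D a) (at level 1, format "a ^!").
Local Notation eps := (cd_eps D).
Local Notation epsm := (cd_epsm D).

Lemma amul0l (a : R) : 0 ** a = 0.
Proof. by have := amulZl 0 (0 : R) a; rewrite !scale0r. Qed.
Lemma amul0r (a : R) : a ** 0 = 0.
Proof. by have := amulZr 0 a (0 : R); rewrite !scale0r. Qed.
Lemma amul_suml I (s : seq I) (F : I -> R) (a : R) :
  (\sum_(i <- s) F i) ** a = \sum_(i <- s) F i ** a.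
Proof.
elim: s => [|i s IH]; first by rewrite !big_nil amul0l.
by rewrite !big_cons amulDl IH.
Qed.
Lemma amul_sumr I (s : seq I) (F : I -> R) (a : R) :
  a ** (\sum_(i <- s) F i) = \sum_(i <- s) a ** F i.
Proof.
elim: s => [|i s IH]; first by rewrite !big_nil amul0r.
by rewrite !big_cons amulDr IH.
Qed.

Lemma star0 : (0 : R)^! = 0.
Proof.
by have := cd_star_lin D (-1) 0 0; rewrite !scaleN1r !oppr0 addr0 addNr.
Qed.
Lemma starZ (k : K) x : (k *: x)^! = k *: x^!.
Proof. by have := cd_star_lin D k x 0; rewrite star0 !addr0. Qed.
Lemma starD x y : (x + y)^! = x^! + y^!.
Proof. by have := cd_star_lin D 1 x y; rewrite !scale1r. Qed.
Lemma star_sum I (s : seq I) (F : I -> R) :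
  (\sum_(i <- s) F i)^! = \sum_(i <- s) (F i)^!.
Proof.
elim: s => [|i s IH]; first by rewrite !big_nil star0.
by rewrite !big_cons starD IH.
Qed.

(* The coefficient of C^l_{S,T} in a. *)
Definition cell_coef l (S T : M l) (a : R) : K := coords (cd_C_basis D) a (C S T).
Local Notation co := cell_coef.

Lemma co_lin l (S T : M l) k a b : co S T (k *: a + b) = k * co S T a + co S T b.
Proof. exact: coords_lin. Qed.
Lemma coD l (S T : M l) a b : co S T (a + b) = co S T a + co S T b.
Proof. by have := co_lin S T 1 a b; rewrite scale1r mul1r. Qed.
Lemma co0 l (S T : M l) : co S T 0 = 0.
Proof.
by have := co_lin S T (-1) 0 0; rewrite scaleN1r oppr0 addr0 mulN1r addNr.
Qed.
Lemma coZ l (S T : M l) k a : co S T (k *: a) = k * co S T a.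
Proof. by have := co_lin S T k a 0; rewrite co0 !addr0. Qed.
Lemma co_sum l (S T : M l) I (s : seq I) (F : I -> R) :
  co S T (\sum_(i <- s) F i) = \sum_(i <- s) co S T (F i).
Proof.
elim: s => [|i s IH]; first by rewrite !big_nil co0.
by rewrite !big_cons coD IH.
Qed.

Lemma coC l (S T S' T' : M l) : co S T (C S' T') = ((S == S') && (T == T'))%:R.
Proof.
rewrite /co coords_mem; last by exists (existT _ l (S', T')).
congr (nat_of_bool _)%:R; apply/eqP/andP => [h|[/eqP-> /eqP->]//].
have := @cd_C_inj _ _ _ D (existT _ l (S, T)) (existT _ l (S', T')) h.
by move/eqP; rewrite -tag_eqE /tag_eq /= eqxx /= tagged_asE xpair_eqE => /andP[].
Qed.

Lemma coC_neq l m (S T : M l) (P Q : M m) : m != l -> co S T (C P Q) = 0.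
Proof.
move=> ml; rewrite /co coords_mem; last by exists (existT _ m (P, Q)).
case: eqP => // h.
have := @cd_C_inj _ _ _ D (existT _ l (S, T)) (existT _ m (P, Q)) h.
by move/(congr1 (@tag _ _)) => /= lm; rewrite lm eqxx in ml.
Qed.

Lemma co_span l (S T : M l) (P : pred X) y :
  ~~ P l -> cell_span (@cd_C _ _ _ D) P y -> co S T y = 0.
Proof.
move=> Pl; move: y; apply: span_ind => [|k a b ha hb|x [m [U [V [Pm ->]]]]].
- exact: co0.
- by rewrite co_lin ha hb mulr0 addr0.
- by apply: coC_neq; apply: contraNneq Pl => <-.
Qed.

Lemma Ceps1 d l (S T : M l) : epsm T = d -> C S T ** eps d = C S T.
Proof.
move=> h; rewrite -[LHS](cd_starK D) cd_starM cd_starC cd_eps_star.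
by rewrite cd_eC1 // cd_starC.
Qed.
Lemma Ceps0 d l (S T : M l) : epsm T <> d -> C S T ** eps d = 0.
Proof.
move=> h; rewrite -[LHS](cd_starK D) cd_starM cd_starC cd_eps_star.
by rewrite cd_eC0 // star0.
Qed.

Lemma co_span_eps l (S T : M l) (P : pred X) d y :
  ~~ P l -> cell_span (@cd_C _ _ _ D) P y -> co S T (y ** eps d) = 0.
Proof.
move=> Pl; move: y; apply: span_ind => [|k a b ha hb|x [m [U [V [Pm ->]]]]].
- by rewrite amul0l co0.
- by rewrite amulDl amulZl co_lin ha hb mulr0 addr0.
have [h|h] := pselect (epsm V = d); last by rewrite Ceps0 // co0.
by rewrite Ceps1 //; apply: coC_neq; apply: contraNneq Pl => <-.
Qed.

Lemma co_star l (S T : M l) y : co S T y^! = co T S y.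
Proof.
have := (cd_C_basis D).2 y; move: y; apply: span_ind => [|k a b ha hb|x].
- by rewrite star0 !co0.
- by rewrite cd_star_lin !co_lin ha hb.
move=> [[m [U V]] _ <-]; rewrite /cell_map /= cd_starC.
have [ml|ml] := eqVneq m l; last by rewrite !coC_neq.
by move: U V; rewrite ml => U V; rewrite !coC andbC.
Qed.

Lemma co_mulC l (S T S' T' : M l) a :
  co S' T' (a ** C S T) = (T' == T)%:R * r a S' S.
Proof.
have [y hy ->] := cd_mulC S T a.
rewrite coD (co_span_eps _ _ _ _ hy) ?cd_lt_irr // addr0 co_sum.
rewrite (bigD1 S') //= coZ coC eqxx big1 ?addr0 1?mulrC // => U neq.
by rewrite coZ coC eq_sym (negPf neq) mulr0.
Qed.

Lemma co_mulC_neq l m (S T : M l) (P Q : M m) a :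
  ~~ cd_lt D (epsm Q) l m -> m != l -> co S T (a ** C P Q) = 0.
Proof.
move=> lm ml; have [y hy ->] := cd_mulC P Q a.
rewrite coD (co_span_eps _ _ _ _ hy) // addr0 co_sum.
by rewrite big1 // => U _; rewrite coZ coC_neq ?mulr0.
Qed.

Lemma co_mul_lower l (S T : M l) d y a :
  cell_span (@cd_C _ _ _ D) (fun m => cd_lt D d m l) y -> co S T (a ** (y ** eps d)) = 0.
Proof.
move: y; apply: span_ind => [|k u v hu hv|x [m [P [Q [ml ->]]]]].
- by rewrite amul0l amul0r co0.
- by rewrite amulDl amulZl amulDr amulZr co_lin hu hv mulr0 addr0.
have [h|h] := pselect (epsm Q = d); last by rewrite Ceps0 // amul0r co0.
rewrite Ceps1 //; apply: co_mulC_neq.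
  rewrite h; apply/negP => lm; have := cd_lt_trans ml lm.
  by rewrite cd_lt_irr.
by apply: contraTneq ml => ->; rewrite cd_lt_irr.
Qed.

Lemma cd_r_co l (S S' T : M l) a : r a S' S = co S' T (a ** C S T).
Proof. by rewrite co_mulC eqxx mul1r. Qed.

Lemma cd_rM l (S S' : M l) a b : r (a ** b) S' S = \sum_U r a S' U * r b U S.
Proof.
rewrite (cd_r_co S S' S) -amulA; have [y hy ->] := cd_mulC S S b.
rewrite amulDr coD co_mul_lower // addr0 amul_sumr co_sum.
by apply: eq_bigr => U _; rewrite amulZr coZ -cd_r_co mulrC.
Qed.

Lemma cd_rD l (S S' : M l) a b : r (a + b) S' S = r a S' S + r b S' S.
Proof. by rewrite !(cd_r_co S S' S) amulDl coD. Qed.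
Lemma cd_rZ l (S S' : M l) k a : r (k *: a) S' S = k * r a S' S.
Proof. by rewrite !(cd_r_co S S' S) amulZl coZ. Qed.
Lemma cd_r0 l (S S' : M l) : r 0 S' S = 0.
Proof. by rewrite (cd_r_co S S' S) amul0l co0. Qed.
Lemma cd_r_sum l (S S' : M l) I (s : seq I) (F : I -> R) :
  r (\sum_(i <- s) F i) S' S = \sum_(i <- s) r (F i) S' S.
Proof.
elim: s => [|i s IH]; first by rewrite !big_nil cd_r0.
by rewrite !big_cons cd_rD IH.
Qed.
Lemma cd_r_unit l (S S' : M l) u : is_unit u -> r u S' S = (S' == S)%:R.
Proof.
by move=> hu; rewrite (cd_r_co S S' S) (hu _).1 coC eqxx andbT.
Qed.

Lemma Cmul l (S T : M l) a :
  exists2 y : R, cell_span (@cd_C _ _ _ D) (fun m => cd_lt D (epsm S) m l) y &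
    C S T ** a = \sum_(T' : M l) r a^! T' T *: C S T' + eps (epsm S) ** y^!.
Proof.
have [y hy e] := cd_mulC T S a^!; exists y => //.
rewrite -[LHS](cd_starK D) cd_starM cd_starC e starD star_sum cd_starM cd_eps_star.
by congr (_ + _); apply: eq_bigr => U _; rewrite starZ cd_starC.
Qed.

Lemma co_eps_span l (S T : M l) (P : pred X) d y :
  ~~ P l -> cell_span (@cd_C _ _ _ D) P y -> co S T (eps d ** y^!) = 0.
Proof.
move=> Pl hy; rewrite -cd_eps_star -cd_starM co_star.
exact: co_span_eps hy.
Qed.

Lemma cd_r_lower l (S T : M l) y :
  cell_span (@cd_C _ _ _ D) (fun m => cd_lt D (epsm S) m l) y -> r (eps (epsm S) ** y^!) S T = 0.
Proof.
move: y; apply: span_ind => [|k u v hu hv|x [m [P [Q [ml ->]]]]].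
- by rewrite star0 amul0r cd_r0.
- by rewrite cd_star_lin amulDr amulZr cd_rD cd_rZ hu hv mulr0 addr0.
rewrite cd_starC; have [h|h] := pselect (epsm Q = epsm S); last first.
  by rewrite cd_eC0 // cd_r0.
rewrite cd_eC1 // (cd_r_co T S S) -[_ ** _](cd_starK D) co_star cd_starM !cd_starC.
apply: co_mulC_neq.
  rewrite h; apply/negP => lm; have := cd_lt_trans ml lm.
  by rewrite cd_lt_irr.
by apply: contraTneq ml => ->; rewrite cd_lt_irr.
Qed.

Lemma form_swap l (U V S T : M l) : r (C U S) U T = r (C V T) V S.
Proof.
rewrite (cd_r_co T U V); have [y hy ->] := Cmul U S (C T V).
rewrite coD (co_eps_span _ _ _ _ hy) ?cd_lt_irr // addr0 co_sum cd_starC.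
rewrite (bigD1 V) //= coZ coC !eqxx mulr1 big1 ?addr0 // => W neq.
by rewrite coZ coC eqxx eq_sym (negPf neq) mulr0.
Qed.

Lemma form_indep l (U V S T : M l) : r (C U S) U T = r (C V S) V T.
Proof. by rewrite (form_swap U U) (form_swap U V). Qed.

Lemma form_adj l (U S T : M l) a :
  \sum_(T' : M l) r a T' T * r (C U S) U T' =
  \sum_(S' : M l) r a^! S' S * r (C U S') U T.
Proof.
transitivity (r (C U S ** a) U T).
  by rewrite cd_rM; apply: eq_bigr => T' _; rewrite mulrC.
have [y hy ->] := Cmul U S a; rewrite cd_rD cd_r_lower // addr0 cd_r_sum.
by apply: eq_bigr => W _; rewrite cd_rZ.
Qed.

(* [Delta(l)] as a vector space: [x] stands for [\sum_S x S *: m^l_S]. *)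
Definition cell_space (l : X) := {ffun M l -> K^o}.

Definition cell_basis l (S : M l) : cell_space l := [ffun T => (T == S)%:R].

Definition cell_act l (a : R) (x : cell_space l) : cell_space l :=
  [ffun S' => \sum_S x S * r a S' S].

Lemma cell_act_basis l a (S : M l) :
  cell_act a (cell_basis S) = \sum_S' r a S' S *: cell_basis S'.
Proof.
apply/ffunP => T; rewrite ffunE sum_ffunE (bigD1 S) //= !ffunE eqxx mul1r.
rewrite big1 ?addr0 => [|U /negPf US]; last by rewrite ffunE US mul0r.
rewrite (bigD1 T) //= !ffunE eqxx big1 ?addr0 => [|U /negPf US].
  by rewrite /GRing.scale /= mulr1.
by rewrite !ffunE eq_sym US scaler0.
Qed.

Lemma cell_actDl l a b (x : cell_space l) :
  cell_act (a + b) x = cell_act a x + cell_act b x.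
Proof.
apply/ffunP => S; rewrite !ffunE -big_split /=.
by apply: eq_bigr => T _; rewrite cd_rD mulrDr.
Qed.
Lemma cell_actZl l (k : K) a (x : cell_space l) :
  cell_act (k *: a) x = k *: cell_act a x.
Proof.
apply/ffunP => S; rewrite !ffunE scaler_sumr.
by apply: eq_bigr => T _; rewrite cd_rZ mulrCA.
Qed.
Lemma cell_actDr l a (x y : cell_space l) :
  cell_act a (x + y) = cell_act a x + cell_act a y.
Proof.
apply/ffunP => S; rewrite !ffunE -big_split /=.
by apply: eq_bigr => T _; rewrite ffunE mulrDl.
Qed.
Lemma cell_actZr l (k : K) a (x : cell_space l) :
  cell_act a (k *: x) = k *: cell_act a x.
Proof.
apply/ffunP => S; rewrite !ffunE scaler_sumr.
by apply: eq_bigr => T _; rewrite ffunE -[LHS]mulrA.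
Qed.
Lemma cell_actM l a b (x : cell_space l) :
  cell_act (a ** b) x = cell_act a (cell_act b x).
Proof.
apply/ffunP => S; rewrite !ffunE.
under eq_bigr do rewrite cd_rM mulr_sumr.
rewrite exchange_big /=; apply: eq_bigr => U _; rewrite ffunE mulr_suml.
by apply: eq_bigr => T _; rewrite -mulrA [r b _ _ * _]mulrC.
Qed.
Lemma cell_act_unit u : is_unit u -> forall l (x : cell_space l), cell_act u x = x.
Proof.
move=> hu l x; apply/ffunP => S; rewrite ffunE (bigD1 S) //= cd_r_unit // eqxx.
rewrite mulr1 big1 ?addr0 // => T /negPf TS.
by rewrite cd_r_unit // eq_sym TS mulr0.
Qed.

Definition Delta (l : X) : lmodule R :=
  LModule (@cell_actDl l) (@cell_actZl l) (@cell_actDr l) (@cell_actZr l)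
    (@cell_actM l) (fun u hu x => @cell_act_unit u hu l x).

(* The right action on [Delta(l)^star], which has the same underlying space. *)
Definition cell_ract l (x : cell_space l) (a : R) : cell_space l := cell_act a^! x.

Definition Delta_star_mul l (e : R) : {vspace cell_space l} :=
  (linfun (fun x : cell_space l => cell_ract x e) @: fullv)%VS.

(* An arbitrary element of M(l), used to define the form; see [PhiE]. *)
Definition cell_pt (l : X) : M l := enum_val (Ordinal (cd_M_nonempty D l)).

Definition Phi l (x y : cell_space l) : K :=
  \sum_S \sum_T x S * y T * r (C (cell_pt l) S) (cell_pt l) T.

Lemma PhiE l (U S T : M l) : Phi (cell_basis S) (cell_basis T) = r (C U S) U T.
Proof.
rewrite /Phi (bigD1 S) //= (bigD1 T) //= !ffunE !eqxx !mul1r.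
rewrite big1 ?addr0 => [|V /negPf VT]; last by rewrite !ffunE VT mulr0 mul0r.
rewrite big1 ?addr0 => [|V /negPf VT]; first exact: form_indep.
by rewrite big1 // => W _; rewrite ffunE VT !mul0r.
Qed.

Lemma Phi_lin l (k : K) (x x' y : cell_space l) :
  Phi (k *: x + x') y = k * Phi x y + Phi x' y.
Proof.
rewrite /Phi mulr_sumr -big_split /=; apply: eq_bigr => S _.
rewrite mulr_sumr -big_split /=; apply: eq_bigr => T _.
by rewrite !ffunE !mulrDl /GRing.scale /= !mulrA.
Qed.

Lemma Phi_adj l a (x y : cell_space l) : Phi (cell_act a x) y = Phi x (cell_act a^! y).
Proof.
rewrite /Phi; set U := cell_pt l.
transitivity (\sum_S \sum_T x S * y T * \sum_S' (r a S' S * r (C U S') U T)).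
  rewrite exchange_big [RHS]exchange_big /=; apply: eq_bigr => T _.
  under eq_bigr => S' _ do rewrite ffunE !mulr_suml.
  rewrite exchange_big /=; apply: eq_bigr => S _.
  rewrite mulr_sumr; apply: eq_bigr => S' _.
  by rewrite !mulrA; congr (_ * _); rewrite mulrAC.
apply: eq_bigr => S _.
have h T : \sum_S' (r a S' S * r (C U S') U T) = \sum_T' r a^! T' T * r (C U S) U T'.
  by rewrite form_adj cd_starK.
under eq_bigr do rewrite h mulr_sumr.
rewrite exchange_big /=; apply: eq_bigr => T' _; rewrite ffunE mulr_sumr mulr_suml.
by apply: eq_bigr => T _; rewrite !mulrA.
Qed.

Definition cell_rad_pred (l : X) : {pred Delta l} :=
  [pred x : cell_space l | `[< forall y : cell_space l, Phi x y = 0 >]].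

Lemma cell_radP l (x : cell_space l) :
  reflect (forall y : cell_space l, Phi x y = 0) (x \in @cell_rad_pred l).
Proof. exact: asboolP. Qed.

Lemma cell_rad_lin l : submod_closed (@cell_rad_pred l).
Proof.
split=> [|k x y].
  apply/cell_radP => y; rewrite /Phi big1 // => S _.
  by rewrite big1 // => T _; rewrite ffunE !mul0r.
move=> /cell_radP hx /cell_radP hy; apply/cell_radP => z.
by rewrite [LHS]Phi_lin hx hy mulr0 addr0.
Qed.
Lemma cell_rad_act l a (x : Delta l) :
  x \in @cell_rad_pred l -> act a x \in @cell_rad_pred l.
Proof.
move=> /cell_radP hx; apply/cell_radP => z.
by rewrite [LHS]Phi_adj hx.
Qed.

Definition cell_rad (l : X) : submodule (Delta l) :=
  Submodule (@cell_rad_lin l) (@cell_rad_act l).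

(* Only meaningful for [l] in [X0]: otherwise it is the zero module. *)
Definition simple_L (l : X) : lmodule R := quo (cell_rad l).

Definition in_X0 (l : X) : Prop := exists x y : cell_space l, Phi x y <> 0.

Definition cell_le (d : cd_E D) : rel X := fun m l => (m == l) || cd_lt D d m l.

End CellTheory.

Section Matrices.
Variables (K : fieldType) (R : algebra K) (X : finType) (D : cell_datum R X).

Definition X0 : {set X} := [set l | `[< in_X0 D l >]].

Definition decomposition_mx : 'M[nat]_(#|X|, #|X0|) :=
  \matrix_(i, j) JHmult (Delta D (enum_val i)) (simple_L D (enum_val j)).

(* [P l] plays the role of the projective P(l), for [l] in [X0]. *)
Definition cartan_mx (P : X -> lmodule R) : 'M[nat]_#|X0| :=
  \matrix_(i, j) JHmult (P (enum_val i)) (simple_L D (enum_val j)).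

End Matrices.

(* Main.v *)
From HB Require Import structures.
Require Import Defs.
From mathcomp Require Import all_boot all_order all_algebra.
From mathcomp Require Import boolp classical_sets.

Set Implicit Arguments.
Unset Strict Implicit.
Unset Printing Implicit Defensive.

Import GRing.Theory.
Local Open Scope ring_scope.

(* For an idempotent [e] that kills every simple module not isomorphic to [L]
   and has rank one on [L], the dimension of [e N] counts the factors [L] in a
   composition series of [N].  If [R e] has head [L(l)], then [e] has these
   properties: two vectors of [e L(l)] have the same annihilator, and [L(l)]
   has enough rank one operators, given by its nondegenerate form, for this to
   force them to be proportional.  Adjunction for the form gives the same for
   [e^star], hence (a).  For (b), [P(l) : L(m)] is the rank of the idempotent
   operator [a |-> f a e] on [R].  In the cellular basis it is block triangular
   for the order of [l], and its block at [n] is the tensor product of the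
   actions of [f] and [e^star] on [Delta(n)]; ranks of diagonal blocks add up
   because the operator is idempotent. *)

(** * Subspaces of a finite-dimensional vector space *)

Section LinearAlgebra.
Variables (K : fieldType).

Definition to_linear (U V : lmodType K) (f : U -> V) (hf : linear f) :
  {linear U -> V} := HB.pack f (GRing.isLinear.Build K U V _ f hf).

Lemma limg_linfunP (U V : vectType K) (f : U -> V) (hf : linear f) v :
  v \in limg (linfun f) <-> exists x, v = f x.
Proof.
have fE x : linfun f x = f x := lfunE (to_linear hf) x.
split=> [/memv_imgP[x _ ->]|[x ->]]; first by exists x.
by rewrite -fE memv_img ?memvf.
Qed.

(** A subspace of largest dimension inside [S] is all of [S]: adding the line of a further vector of
    [S] would enlarge it. This turns images described by a [Prop] into [{vspace V}]. *)
Lemma closed_vspace (V : vectType K) (S : V -> Prop) : S 0 ->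
    (forall (k : K) x y, S x -> S y -> S (k *: x + y)) ->
  exists U : {vspace V}, forall v, v \in U <-> S v.
Proof.
move=> S0 SD.
pose P n := `[< exists U : {vspace V}, \dim U = n /\ forall v, v \in U -> S v >].
have exP : exists n, P n.
  exists 0%N; apply/asboolP; exists 0%VS; split; first exact: dimv0.
  by move=> v; rewrite memv0 => /eqP ->.
have ubP n : P n -> (n <= \dim {:V})%N.
  by move=> /asboolP[U [<- _]]; apply/dimvS/subvf.
have [n /asboolP[U [dU US]] maxn] := ex_maxnP exP ubP.
exists U => v; split=> [/US //|Sv]; apply/negPn/negP => vU.
have /maxn : P (\dim (U + <[v]>)).
  apply/asboolP; exists (U + <[v]>)%VS; split=> // w.
  move=> /memv_addP[x /US xU [y /vlineP[k ->] ->]].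
  by rewrite addrC; apply: SD.
rewrite -dU; apply/negP; rewrite -ltnNge.
rewrite (ltn_leqif (dimv_leqif_sup (addvSl U <[v]>))).
by apply: contra vU => /(subvP)/(_ v); apply; rewrite memvE addvSr.
Qed.

Lemma dim_add_vline (V : vectType K) (U : {vspace V}) v :
  v \notin U -> \dim (U + <[v]>) = (\dim U).+1.
Proof.
move=> vU; rewrite dimv_disjoint_sum ?dim_vline; last first.
  apply/eqP; rewrite -subv0; apply/subvP => w; rewrite memv_cap memv0.
  move=> /andP[wU /vlineP[k wE]]; move: wU.
  by rewrite wE rpredZeq scaler_eq0 (negPf vU) orbF => ->.
have -> : v != 0 by apply: contraNneq vU => ->; rewrite mem0v.
by rewrite addn1.
Qed.

End LinearAlgebra.

(** * Modules, isomorphisms and subquotients *)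

Section Modules.
Variables (K : fieldType) (R : algebra K).
Implicit Types (N Q L P : lmodule R) (a e : R).

Lemma act0l N (x : N) : act 0 x = 0.
Proof. by have := actZl 0 0 x; rewrite !scale0r. Qed.
Lemma act0r N a : act a (0 : N) = 0.
Proof. by have := actZr 0 a (0 : N); rewrite !scale0r. Qed.
Lemma actBl N a b (x : N) : act (a - b) x = act a x - act b x.
Proof. by rewrite actDl -scaleN1r actZl scaleN1r. Qed.
Lemma actBr N a (x y : N) : act a (x - y) = act a x - act a y.
Proof. by rewrite actDr -scaleN1r actZr scaleN1r. Qed.
Lemma act_suml N I (s : seq I) (F : I -> R) (x : N) :
  act (\sum_(i <- s) F i) x = \sum_(i <- s) act (F i) x.
Proof.
elim: s => [|i s IH]; first by rewrite !big_nil act0l.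
by rewrite !big_cons actDl IH.
Qed.

Lemma closed_submodule N (S : N -> Prop) : S 0 ->
    (forall (k : K) x y, S x -> S y -> S (k *: x + y)) ->
    (forall a x, S x -> S (act a x)) ->
  exists U : submodule N, forall x, x \in U <-> S x.
Proof.
move=> S0 SD Sa; pose p : {pred N} := [pred x | `[< S x >]].
have pP x : reflect (S x) (x \in p) by apply: asboolP.
have lin : submod_closed p.
  by split=> [|k x y /pP hx /pP hy]; apply/pP; [apply: S0 | apply: SD].
have pa a x : x \in p -> act a x \in p by move=> /pP hx; apply/pP/Sa.
by exists (Submodule lin pa) => x; split=> [/pP|hx]; last apply/pP.
Qed.

Lemma sm0 N (U : submodule N) : 0 \in U.
Proof. exact: (rpred0 (sm_pred U)). Qed.
Lemma smD N (U : submodule N) x y : x \in U -> y \in U -> x + y \in U.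
Proof. exact: (@rpredD _ (sm_pred U)). Qed.
Lemma smZ N (U : submodule N) (k : K) x : x \in U -> k *: x \in U.
Proof. exact: (@rpredZ _ _ (sm_pred U)). Qed.

Lemma zero_submodule N : exists U : submodule N, forall x, x \in U <-> x = 0.
Proof.
apply: closed_submodule => // [k x y -> ->|a x ->]; last exact: act0r.
by rewrite scaler0 addr0.
Qed.

Lemma full_submodule N : exists U : submodule N, sm_full U.
Proof.
have [U hU] : exists U : submodule N, forall x, x \in U <-> True.
  exact: closed_submodule.
by exists U => x; apply/hU.
Qed.

(** An isomorphism given by its graph. Since [rho] is closed under differences, it is single-valued
    and injective once only 0 is related to 0; maps on quotients can thus be given on
    representatives. *)
Lemma iso_of_rel N Q (rho : N -> Q -> Prop) :
    (forall (k : K) x y x' y', rho x x' -> rho y y' ->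
       rho (k *: x + y) (k *: x' + y')) ->
    (forall a x x', rho x x' -> rho (act a x) (act a x')) ->
    (forall x, exists x', rho x x') -> (forall x', exists x, rho x x') ->
    (forall x', rho 0 x' -> x' = 0) -> (forall x, rho x 0 -> x = 0) ->
  lmod_iso N Q.
Proof.
move=> rD ra tot sur fun0 inj0.
have rB x y x' y' : rho x x' -> rho y y' -> rho (x - y) (x' - y').
  move=> hx hy; have := rD (-1) y x y' x' hy hx.
  by rewrite !scaleN1r ![- _ + _]addrC.
have funl x x' y' : rho x x' -> rho x y' -> x' = y'.
  by move=> h1 h2; have := rB _ _ _ _ h1 h2; rewrite subrr => /fun0/subr0_eq.
have injl x y x' : rho x x' -> rho y x' -> x = y.
  by move=> h1 h2; have := rB _ _ _ _ h1 h2; rewrite subrr => /inj0/subr0_eq.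
have [f hf] := choice tot; have [g hg] := choice sur.
have lin : linear f by move=> k x y; apply: funl (hf _) _; apply: rD.
exists (to_linear lin); split=> [a x|]; first by apply: funl (hf _) _; apply: ra.
by exists g => x /=; [apply: injl (hg _) _ | apply: funl (hf _) _].
Qed.

Lemma iso_sym N Q : lmod_iso N Q -> lmod_iso Q N.
Proof.
move=> [f [eqf [g fK gK]]].
apply: (@iso_of_rel Q N (fun y x => y = f x)).
- by move=> k x y x' y' -> ->; rewrite linearP.
- by move=> a x x' ->; rewrite eqf.
- by move=> x; exists (g x); rewrite gK.
- by move=> x; exists (f x).
- by move=> x /esym; rewrite -(linear0 f) => /(can_inj fK).
- by move=> x ->; rewrite linear0.
Qed.

Lemma iso_trans N Q L : lmod_iso N Q -> lmod_iso Q L -> lmod_iso N L.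
Proof.
move=> [f [eqf [f' fK f'K]]] [g [eqg [g' gK g'K]]].
apply: (@iso_of_rel N L (fun x y => y = g (f x))).
- by move=> k x y x' y' -> ->; rewrite !linearP.
- by move=> a x x' ->; rewrite eqf eqg.
- by move=> x; exists (g (f x)).
- by move=> x; exists (f' (g' x)); rewrite f'K g'K.
- by move=> x ->; rewrite !linear0.
- by move=> x /esym; rewrite -(linear0 g) -(linear0 f) => /(can_inj gK)/(can_inj fK).
Qed.

Lemma iso_simple N Q : lmod_iso N Q -> simple_mod N -> simple_mod Q.
Proof.
move=> [f [eqf [g fK gK]]] [[x x0] sN]; split.
  by exists (f x); rewrite -(linear0 f) => /(can_inj fK).
move=> U; have [V hV] : exists V : submodule N, forall x, x \in V <-> f x \in U.
  apply: closed_submodule => [|k y z|a y]; first by rewrite linear0 sm0.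
    by rewrite linearP => hy hz; apply: smD => //; apply: smZ.
  by rewrite eqf; apply: sm_act.
have [V0|V1] := sN V; [left|right] => y.
  by rewrite -[y]gK => /hV/V0 ->; rewrite linear0.
by rewrite -[y]gK; apply/hV/V1.
Qed.

Lemma quo_pi_eq0 N (W : submodule N) x : quo_pi W x = 0 <-> x \in W.
Proof.
have pi0 : quo_pi W 0 = 0.
  by have := quo_piZ W 0 0; rewrite !scale0r.
rewrite -pi0 -[in X in _ <-> X](subr0 x).
by split=> h; apply/quo_piP.
Qed.

Lemma act_quo_pi N (W : submodule N) a x :
  act a (quo_pi W x : quo W) = quo_pi W (act a x).
Proof. exact: quo_act_pi. Qed.

Lemma quo_piP_lin N (W : submodule N) (k : K) x y :
  quo_pi W (k *: x + y) = k *: (quo_pi W x : quo W) + quo_pi W y.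
Proof. by rewrite quo_piD quo_piZ. Qed.

Lemma simple_quo_maximal N (W : submodule N) :
  simple_mod (quo W) -> maximal_sm W.
Proof.
move=> [[x x0] sW]; split=> [W1|T WT].
  by apply: x0; rewrite -[x]quo_piK; apply/quo_pi_eq0.
have [V hV] : exists V : submodule (quo W),
    forall q, q \in V <-> exists2 y, y \in T & q = quo_pi W y.
  apply: closed_submodule.
  - by exists 0; [apply: sm0|apply/esym/quo_pi_eq0/sm0].
  - move=> k _ _ [y yT ->] [z zT ->]; exists (k *: y + z); last by rewrite quo_piP_lin.
    by apply: smD => //; apply: smZ.
  - by move=> a _ [y yT ->]; exists (act a y); [apply: sm_act|rewrite act_quo_pi].
have [V0|V1] := sW V; [right|left] => y.
  by move=> yT; apply/quo_pi_eq0/V0/hV; exists y.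
have /hV[z zT /quo_piP/WT] := V1 (quo_pi W y).
by move=> /smD/(_ zT); rewrite subrK.
Qed.

Section Subquotients.
Variables (N : lmodule R) (U W : submodule N).

Definition subquo_pi x (xU : x \in U) : subquo U W :=
  quo_pi (sm_pull U W) (SubCar xU).

Lemma subquo_pi_eq0 x (xU : x \in U) : subquo_pi xU = 0 <-> x \in W.
Proof. by rewrite quo_pi_eq0. Qed.

Lemma subquo_piP q : exists x (xU : x \in U), q = subquo_pi xU.
Proof.
rewrite -[q]quo_piK; case: (repr _) => x xU; by exists x, xU.
Qed.

Lemma subquo_pi_lin (k : K) x y (xU : x \in U) (yU : y \in U)
  (zU : k *: x + y \in U) :
  subquo_pi zU = k *: subquo_pi xU + subquo_pi yU.
Proof. by rewrite -[RHS]quo_piP_lin; congr quo_pi; apply/val_inj. Qed.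

Lemma subquo_pi_act a x (xU : x \in U) (axU : act a x \in U) :
  subquo_pi axU = act a (subquo_pi xU).
Proof. by rewrite [RHS]act_quo_pi; congr quo_pi; apply/val_inj. Qed.

Lemma subquo_simple : ~ sm_le U W ->
  (forall T : submodule N, sm_le W T -> sm_le T U -> sm_le U T \/ sm_le T W) ->
  sm_le W U -> simple_mod (subquo U W).
Proof.
move=> UW max WU; split.
  apply: contra_notP UW => h x xU; apply/(subquo_pi_eq0 xU); apply: contrapT => x0.
  by apply: h; exists (subquo_pi xU).
move=> S; have [T hT] : exists T : submodule N,
    forall x, x \in T <-> exists xU : x \in U, subquo_pi xU \in S.
  apply: closed_submodule.
  - exists (sm0 U); have -> : subquo_pi (sm0 U) = 0 by apply/subquo_pi_eq0/sm0.
    exact: sm0.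
  - move=> k x y [xU xS] [yU yS].
    have zU : k *: x + y \in U by apply: smD => //; apply: smZ.
    by exists zU; rewrite (subquo_pi_lin xU yU); apply: smD => //; apply: smZ.
  - move=> a x [xU xS]; have aU : act a x \in U by apply: sm_act.
    by exists aU; rewrite (subquo_pi_act xU); apply: sm_act.
have WT : sm_le W T.
  move=> x xW; apply/hT; exists (WU _ xW).
  have -> : subquo_pi (WU _ xW) = 0 by apply/subquo_pi_eq0.
  exact: sm0.
have TU : sm_le T U by move=> x /hT[].
have [UT|TW] := max T WT TU.
- right=> q; have [x [xU ->]] := subquo_piP q.
  by have /hT[xU' h] := UT _ xU; rewrite (bool_irrelevance xU xU').
- left=> q; have [x [xU ->]] := subquo_piP q => xS.
  by apply/subquo_pi_eq0/TW/hT; exists xU.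
Qed.

End Subquotients.

(** * Composition series of finite-dimensional modules *)

Section FiniteDimension.
Variables (N : lmodule R) (V : vectType K) (g : {linear N -> V}).
Hypothesis inj_g : injective g.

Lemma image_vspace (U : submodule N) e : exists E : {vspace V},
  forall v, v \in E <-> exists2 x, x \in U & v = g (act e x).
Proof.
apply: closed_vspace; first by exists 0; rewrite ?sm0 // act0r linear0.
move=> k _ _ [x xU ->] [y yU ->]; exists (k *: x + y).
  by apply: smD => //; apply: smZ.
by rewrite actDr actZr linearP.
Qed.

(** The carrier of a module is only an [lmodType], so finite dimension is expressed by the embedding
    [g] into [V]; the height of [U] is the dimension of its image under [g]. *)
Lemma submodule_height : exists h : submodule N -> nat,
  (forall U W, sm_le W U -> ~ sm_le U W -> (h W < h U)%N) /\
  forall U, (h U <= \dim {:V})%N.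
Proof.
have img (U : submodule N) : exists E : {vspace V},
    forall v, v \in E <-> exists2 x, x \in U & v = g x.
  apply: closed_vspace; first by exists 0; rewrite ?sm0 // linear0.
  move=> k _ _ [x xU ->] [y yU ->]; exists (k *: x + y); last by rewrite linearP.
  by apply: smD => //; apply: smZ.
have [E hE] := choice img; exists (fun U => \dim (E U)); split=> [U W WU UW|U].
  have sWU : (E W <= E U)%VS.
    by apply/subvP => v /hE[x xW ->]; apply/hE; exists x; rewrite ?WU.
  rewrite (ltn_leqif (dimv_leqif_sup sWU)); apply/negP => /subvP sUW.
  apply: UW => x xU; have /sUW/hE[y yW /inj_g ->//] : g x \in E U.
  by apply/hE; exists x.
exact/dimvS/subvf.
Qed.

Lemma exists_maximal (S : submodule N -> Prop) : (exists U, S U) ->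
  exists2 W, S W & forall T, S T -> sm_le W T -> sm_le T W.
Proof.
move=> [U SU]; have [h [hlt hub]] := submodule_height.
pose p n := `[< exists U, S U /\ h U = n >].
have exp : exists n, p n by exists (h U); apply/asboolP; exists U.
have ubp n : p n -> (n <= \dim {:V})%N by move=> /asboolP[T [_ <-]].
have [n /asboolP[W [SW hW]] maxn] := ex_maxnP exp ubp.
exists W => // T ST WT; apply: contrapT => TW.
have /maxn : p (h T) by apply/asboolP; exists T.
by rewrite -hW leqNgt hlt.
Qed.

Lemma exists_comp_series : exists s : comp_series N, True.
Proof.
have [h [hlt _]] := submodule_height.
(* Induction on a bound for the height: a maximal proper submodule of [U] has smaller height, and
   its series is extended by [U]. *)
suff chain n (U : submodule N) : (h U < n)%N ->
    exists len (c : nat -> submodule N),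
    [/\ sm_zero (c 0%N), c len = U,
        forall i, (i < len)%N -> sm_le (c i) (c i.+1) &
        forall i, (i < len)%N -> simple_mod (subquo (c i.+1) (c i))].
  have [U fU] := full_submodule N.
  have [len [c [c0 cU cle cs]]] := chain _ U (ltnSn _).
  by rewrite -cU in fU; exists (CompSeries c0 fU cle cs).
elim: n U => // n IH U; rewrite ltnS => hU.
have [U0|U0] := pselect (sm_zero U); first by exists 0%N, (fun=> U); split.
have [W [WU UW] maxW] :
    exists2 W : submodule N, sm_le W U /\ ~ sm_le U W &
    forall T : submodule N, sm_le T U /\ ~ sm_le U T -> sm_le W T -> sm_le T W.
  apply: exists_maximal; have [Z hZ] := zero_submodule N; exists Z; split.
    by move=> x /hZ ->; apply: sm0.
  by move=> UZ; apply: U0 => x /UZ/hZ.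
have [len [c [c0 cW cle cs]]] := IH W (leq_trans (hlt _ _ WU UW) hU).
exists len.+1, (fun i => if (i <= len)%N then c i else U).
split=> //= [|i|i]; rewrite ?ltnn // ltnS {1}leq_eqVlt => /predU1P[->|il].
- by rewrite leqnn ltnn cW.
- by rewrite il ltnW //; apply: cle.
- rewrite leqnn ltnn cW; apply: subquo_simple => // T WT TU.
  by have [UT|UT] := pselect (sm_le U T); [left|right; apply: maxW].
- by rewrite il ltnW //; apply: cs.
Qed.

End FiniteDimension.

Definition detects e L : Prop :=
  [/\ e ** e = e,
      forall Q, simple_mod Q -> forall x : Q, act e x <> 0 -> lmod_iso Q L &
      exists u : L,
        [/\ u <> 0, act e u = u & forall v, exists k : K, act e v = k *: u]].

(** * Counting composition factors by the rank of an idempotent *)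

Section Multiplicity.
Variables (N L : lmodule R) (V : vectType K) (g : {linear N -> V}) (e : R).
Hypotheses (inj_g : injective g) (eL : detects e L).

(** If the factor is not [L], then [e] kills it, so e U lies in W and e U = e W. If it is [L], a
    lift of [u] fixed by [e] spans e U modulo e W, because e L is the line of [u]. *)
Lemma dim_image_step (U W : submodule N) (E F : {vspace V}) :
    sm_le W U -> simple_mod (subquo U W) ->
    (forall v, v \in E <-> exists2 x, x \in U & v = g (act e x)) ->
    (forall v, v \in F <-> exists2 x, x \in W & v = g (act e x)) ->
  \dim E = (\dim F + `[< lmod_iso (subquo U W) L >])%N.
Proof.
have [ee simp [u [u0 eu uP]]] := eL => WU sUW hE hF.
have eK x : act e (act e x) = act e x :> N by rewrite -actM ee.
have FE : (F <= E)%VS.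
  by apply/subvP => v /hF[x xW ->]; apply/hE; exists x; rewrite ?WU.
case: asboolP => [[phi [eqphi [psi phiK psiK]]]|niso]; last first.
  rewrite addn0; congr (\dim _); apply/eqP; rewrite eqEsubv FE andbT.
  apply/subvP => v /hE[x xU ->]; apply/hF; exists (act e x); last by rewrite eK.
  apply/(subquo_pi_eq0 W (sm_act e xU)); rewrite subquo_pi_act.
  by apply: contrapT => /simp - /(_ sUW).
have [x0 [x0U ux0]] := subquo_piP (psi u).
set x1 := act e x0; have x1U : x1 \in U by apply: sm_act.
have phix1 : phi (subquo_pi W x1U) = u.
  by rewrite (subquo_pi_act _ x0U) -ux0 eqphi psiK.
have x1W : x1 \notin W.
  apply/negP => /(subquo_pi_eq0 W x1U) h; apply: u0.
  by rewrite -phix1 h linear0.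
rewrite addn1 -(@dim_add_vline _ _ F (g x1)); last first.
  apply/negP => /hF[w wW /inj_g x1E]; move/negP: x1W; apply.
  by rewrite x1E; apply: sm_act.
congr (\dim _); apply/eqP; rewrite eqEsubv subv_add FE /=; apply/andP; split.
  apply/subvP => v /hE[x xU ->]; have exU : act e x \in U by apply: sm_act.
  have [k hk] := uP (phi (subquo_pi W xU)).
  have exW : act e x - k *: x1 \in W.
    have zU : - k *: x1 + act e x \in U by apply: smD => //; apply: smZ.
    rewrite addrC -scaleNr; apply/(subquo_pi_eq0 W zU)/(can_inj phiK).
    rewrite (subquo_pi_lin _ x1U exU) linear0 linearP phix1.
    by rewrite (subquo_pi_act _ xU) eqphi hk scaleNr addNr.
  apply/memv_addP; exists (g (act e x - k *: x1)).
    apply/hF; exists (act e x - k *: x1) => //.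
    by rewrite actBr actZr !eK.
  exists (g (k *: x1)); last by rewrite -linearD subrK.
  by rewrite linearZ; apply/memvZ/memv_line.
by rewrite -memvE; apply/hE; exists x1; rewrite ?eK.
Qed.

Lemma cs_mult_dim (s : comp_series N) (E : {vspace V}) :
  (forall v, v \in E <-> exists x, v = g (act e x)) -> cs_mult s L = \dim E.
Proof.
move=> hE; rewrite /cs_mult -sum1_card.
pose b i := `[< lmod_iso (subquo (cs_sub s i.+1) (cs_sub s i)) L >].
transitivity (\sum_(i < cs_len s) b i)%N.
  by rewrite big_mkcond /=; apply: eq_bigr => i _; rewrite inE /b; case: asboolP.
(* The partial sums are the dimensions of [e] applied to the successive terms of the series. *)
suff step i (F : {vspace V}) : (i <= cs_len s)%N ->
    (forall v, v \in F <-> exists2 x, x \in cs_sub s i & v = g (act e x)) ->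
    (\sum_(j < i) b j = \dim F)%N.
  apply: step => // v; rewrite hE; split=> [[x ->]|[x _ ->]]; exists x => //.
  exact: cs_top.
elim: i F => [|i IH] F ilen hF.
  rewrite big_ord0; apply/esym/eqP; rewrite dimv_eq0 -subv0; apply/subvP => v.
  by move=> /hF[x /(cs_bot)-> ->]; rewrite act0r linear0 mem0v.
have [G hG] := image_vspace g (cs_sub s i) e.
rewrite big_ord_recr /= (IH G (ltnW ilen) hG).
apply/esym/(dim_image_step _ _ hF hG); first exact: cs_le.
exact: cs_simple.
Qed.

(** By [cs_mult_dim] every series gives the same count, and finite dimension provides a series, so
    the default 0 of [JHmult] is never taken. *)
Lemma JHmult_dim (E : {vspace V}) :
  (forall v, v \in E <-> exists x, v = g (act e x)) -> JHmult N L = \dim E.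
Proof.
move=> hE; rewrite /JHmult; case: xgetP => [n _ [s <-]|h].
  exact: cs_mult_dim.
have [s _] := exists_comp_series inj_g.
by have := h (cs_mult s L); case; exists s.
Qed.

End Multiplicity.

End Modules.

(** * Cyclic modules R e with simple head *)

Section Generator.
Variables (K : fieldType) (R : algebra K) (P : lmodule R) (e : R) (p : P).
Hypotheses (ee : e ** e = e) (ep : act e p = p).
Hypothesis gen : forall x, exists r, x = act r p.
Hypothesis ann : forall r, act r p = 0 -> r ** e = 0.
Hypothesis head_simple : simple_mod (Defs.head P).

Lemma generator_notin_radical : p \notin radical P.
Proof.
have [nfull _] := simple_quo_maximal head_simple.
apply/negP => prad; apply: nfull => x; have [r ->] := gen x.
exact: sm_act.
Qed.

(** By [ann], a p |-> a e x is well defined; its kernel [Z] is a maximal submodule because [Q] is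
    simple. The radical is contained in [Z] and is itself maximal, the head being simple, so the two
    agree. The right-hand side does not depend on [x], which makes annihilators comparable. *)
Lemma radical_annihilator (Q : lmodule R) (x : Q) r :
  simple_mod Q -> act e x <> 0 -> act (r ** e) x = 0 <-> act r p \in radical P.
Proof.
move=> [_ sQ] ex0.
have annE a b : act a p = act b p -> a ** e = b ** e.
  move=> ab; have h : act (a - b) p = 0 by rewrite actBl ab subrr.
  have := ann h; rewrite amulDl -scaleN1r amulZl scaleN1r.
  exact: subr0_eq.
have [Z hZ] : exists Z : submodule P,
    forall q, q \in Z <-> exists2 a, q = act a p & act (a ** e) x = 0.
  apply: closed_submodule.
  - by exists 0; rewrite ?act0l // -(act0l (act e x)) actM.
  - move=> k _ _ [a -> ha] [b -> hb]; exists (k *: a + b).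
      by rewrite actDl actZl.
    by rewrite amulDl amulZl actDl actZl ha hb scaler0 addr0.
  - move=> b _ [a -> ha]; exists (b ** a); first by rewrite actM.
    by rewrite -amulA actM ha act0r.
have ZE a : act a p \in Z <-> act (a ** e) x = 0.
  by split=> [/hZ[b /annE -> //]|h]; apply/hZ; exists a.
have maxZ : maximal_sm Z.
  split=> [/(_ p)|W ZW]; first by rewrite -{1}ep => /ZE; rewrite ee.
  have [V hV] : exists V : submodule Q,
      forall q, q \in V <-> exists2 a, q = act (a ** e) x & act a p \in W.
    apply: closed_submodule.
    - exists 0; last by rewrite act0l sm0.
      by rewrite actM act0l.
    - move=> k _ _ [a -> ha] [b -> hb]; exists (k *: a + b).
        by rewrite amulDl amulZl actDl actZl.
      by rewrite actDl actZl; apply: smD => //; apply: smZ.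
    - move=> b _ [a -> ha]; exists (b ** a); first by rewrite -actM amulA.
      by rewrite actM; apply: sm_act.
  have [V0|V1] := sQ V; [right|left] => y; have [a ->] := gen y.
    by move=> aW; apply/ZE/V0/hV; exists a.
  have /hV[b hb bW] := V1 (act e x); apply: sm_act.
  (* Since b e x = e x, the vector (e - b) p lies in the kernel [Z], hence in [W]; adding b p gives
     p. *)
  have : act (e - b) p \in W.
    apply/ZW/ZE; rewrite amulDl ee -[- b]scaleN1r amulZl scaleN1r.
    by rewrite actBl -hb subrr.
  by move=> /smD/(_ bW); rewrite actBl subrK ep.
have [nfull maxrad] := simple_quo_maximal head_simple.
have radZ : sm_le (radical P) Z by move=> y /radicalP; apply.
have Zrad : sm_le Z (radical P).
  by have [/maxZ.1|//] := maxrad Z radZ.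
by rewrite -ZE; split=> [/Zrad|/radZ].
Qed.

(** The isomorphism matches a e x with the class of a p; [radical_annihilator] makes this well
    defined and injective, and R e x is all of [Q] by simplicity. *)
Lemma iso_head (Q : lmodule R) (x : Q) :
  simple_mod Q -> act e x <> 0 -> lmod_iso Q (Defs.head P).
Proof.
move=> sQ ex0; have rad r := radical_annihilator r sQ ex0.
apply: (@iso_of_rel _ _ Q (Defs.head P) (fun q h => exists2 r,
  q = act (r ** e) x & h = quo_pi (radical P) (act r p))).
- move=> k _ _ _ _ [a -> ->] [b -> ->]; exists (k *: a + b).
    by rewrite amulDl amulZl actDl actZl.
  by rewrite actDl actZl quo_piP_lin.
- move=> b _ _ [a -> ->]; exists (b ** a); first by rewrite -actM amulA.
  by rewrite act_quo_pi actM.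
- have [V hV] : exists V : submodule Q,
      forall q, q \in V <-> exists a, q = act (a ** e) x.
    apply: closed_submodule.
    - by exists 0; rewrite actM act0l.
    - move=> k _ _ [a ->] [b ->]; exists (k *: a + b).
      by rewrite amulDl amulZl actDl actZl.
    - by move=> b _ [a ->]; exists (b ** a); rewrite -actM amulA.
  move=> q; have [V0|V1] := sQ.2 V.
    by case: ex0; apply/V0/hV; exists e; rewrite ee.
  by have /hV[a ->] := V1 q; exists (quo_pi (radical P) (act a p)), a.
- move=> h; have [r hr] := gen (repr h); exists (act (r ** e) x), r => //.
  by rewrite -hr quo_piK.
- by move=> h [r /esym/rad hr ->]; apply/quo_pi_eq0.
- by move=> q [r -> /esym/quo_pi_eq0/rad].
Qed.

End Generator.

(** * Cellular coefficients, the form and rank one operators *)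

Section Cells.
Variables (K : fieldType) (R : algebra K) (X : finType) (D : cell_datum R X).

Local Notation M := (cd_M D).
Local Notation C := (cd_C D).
Local Notation r := (cd_r D).
Local Notation "a ^!" := (cd_star D a) (at level 1, format "a ^!").
Local Notation eps := (cd_eps D).
Local Notation epsm := (cd_epsm D).
Local Notation co := (cell_coef (D := D)).

Lemma cell_expand a :
  a = \sum_(i : {l : X & (M l * M l)%type})
        co (tagged i).1 (tagged i).2 a *: C (tagged i).1 (tagged i).2.
Proof.
have := (cd_C_basis D).2 a; move: a; apply: span_ind => [|k a b ha hb|_ [i _ <-]].
- by rewrite big1 // => i _; rewrite co0 scale0r.
- rewrite {1}ha {1}hb scaler_sumr -big_split /=; apply: eq_bigr => i _.
  by rewrite co_lin scalerDl scalerA.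
rewrite (bigD1 i) //= /cell_map coC !eqxx scale1r big1 ?addr0 // => j ji.
case: i j ji => [l [S T]] [m [P Q]] /= ji.
have [ml|ml] := eqVneq m l; last by rewrite coC_neq ?scale0r 1?eq_sym.
move: P Q ji; rewrite ml => P Q; rewrite -tag_eqE /tag_eq /= eqxx tagged_asE.
rewrite xpair_eqE coC /= => /negPf ->.
by rewrite scale0r.
Qed.

Lemma cell_coef_eq a b :
  (forall l (S T : M l), co S T a = co S T b) -> a = b.
Proof.
by move=> h; rewrite (cell_expand a) (cell_expand b); under eq_bigr do rewrite h.
Qed.

Lemma cell_coef_span (P : pred X) a :
  (forall l (S T : M l), ~~ P l -> co S T a = 0) -> cell_span (@cd_C _ _ _ D) P a.
Proof.
move=> h; exists [seq C (tagged i).1 (tagged i).2 |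
  i : {l : X & (M l * M l)%type} <- enum {: {l : X & (M l * M l)%type}} & P (tag i)].
exists (fun x => coords (cd_C_basis D) a x); split.
  move=> x /mapP[[l [S T]]]; rewrite mem_filter => /andP[/= Pl _] ->.
  by exists l, S, T.
rewrite {1}(cell_expand a) big_map big_filter big_enum_cond [RHS]big_mkcond /=.
apply: eq_bigr => -[l [S T]] _ /=; case: ifPn => // /(h l S T) ->.
by rewrite scale0r.
Qed.

Lemma co_eps_l l (S T : M l) d a : eps d ** a = a -> epsm S <> d -> co S T a = 0.
Proof.
move=> da Sd; rewrite -da (cell_expand a) amul_sumr co_sum big1 // => -[m [P Q]] _ /=.
rewrite amulZr coZ; have [h|h] := pselect (epsm P = d); last first.
  by rewrite cd_eC0 // co0 mulr0.
rewrite cd_eC1 //; have [ml|ml] := eqVneq m l; last by rewrite coC_neq ?mulr0.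
move: P Q h; rewrite ml => P Q h; rewrite coC.
have [SP|] := eqVneq S P; last by rewrite mulr0.
by case: Sd; rewrite SP.
Qed.

Lemma cd_r_eps_l l (S' S : M l) d a :
  eps d ** a = a -> epsm S' <> d -> r a S' S = 0.
Proof.
move=> da Sd; rewrite (cd_r_co S S' S); apply: co_eps_l Sd.
by rewrite amulA da.
Qed.

Lemma Phi_sym l (x y : cell_space D l) : Phi x y = Phi y x.
Proof.
rewrite /Phi exchange_big; apply: eq_bigr => S _; apply: eq_bigr => T _.
by rewrite (form_swap _ (cell_pt D l)) [x T * _]mulrC.
Qed.

Lemma Phi_linr l (k : K) (x y y' : cell_space D l) :
  Phi x (k *: y + y') = k * Phi x y + Phi x y'.
Proof. by rewrite !(Phi_sym x) Phi_lin. Qed.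

Lemma PhiZr l (k : K) (x y : cell_space D l) : Phi x (k *: y) = k * Phi x y.
Proof.
have h0 : Phi x 0 = 0.
  by have := Phi_linr (-1) x 0 0; rewrite scaler0 addr0 mulN1r addNr.
by have := Phi_linr k x y 0; rewrite addr0 h0 addr0.
Qed.

Lemma PhiBr l (x y y' : cell_space D l) : Phi x (y - y') = Phi x y - Phi x y'.
Proof. by rewrite addrC -scaleN1r Phi_linr mulN1r addrC. Qed.

(** By the right-handed rule [Cmul], the product of C S T and C U U only involves elements C S V of
    the cell [l], so only the row of S survives. *)
Lemma cd_r_C l (S T S' U : M l) :
  r (C S T) S' U = (S' == S)%:R * r (C S T) S U.
Proof.
have [->|SS] := eqVneq S' S; first by rewrite mul1r.
rewrite mul0r (cd_r_co U S' U); have [y hy ->] := Cmul S T (C U U).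
rewrite coD (co_eps_span _ _ _ _ hy) ?cd_lt_irr // addr0 co_sum.
by rewrite big1 // => V _; rewrite coZ coC (negPf SS) mulr0.
Qed.

(** An element of [R] that induces on [Delta D l] the rank one operator z |-> Phi y z *: x. *)
Definition cell_rank1 l (x y : cell_space D l) : R :=
  \sum_S \sum_T (x S * y T) *: C S T.

Lemma cell_act_rank1 l (x y z : cell_space D l) :
  cell_act (cell_rank1 x y) z = Phi y z *: x.
Proof.
apply/ffunP => S; rewrite !ffunE /cell_rank1.
transitivity (\sum_U \sum_T z U * (x S * y T * r (C S T) S U)).
  apply: eq_bigr => U _; rewrite cd_r_sum (bigD1 S) //= [X in _ + X]big1 ?addr0.
    by rewrite cd_r_sum mulr_sumr; apply: eq_bigr => T _; rewrite cd_rZ.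
  move=> V VS; rewrite cd_r_sum big1 // => T _.
  by rewrite cd_rZ cd_r_C eq_sym (negPf VS) mul0r mulr0.
rewrite exchange_big /Phi /GRing.scale /= mulr_suml; apply: eq_bigr => T _.
rewrite mulr_suml; apply: eq_bigr => U _.
rewrite (form_indep (cell_pt D l) S).
by rewrite [RHS]mulrC !mulrA; congr (_ * _); rewrite -mulrA mulrC.
Qed.

Lemma in_X0_nondegenerate l (q : simple_L D l) : q <> 0 ->
  exists x y : cell_space D l, q = quo_pi (cell_rad D l) x /\ Phi y x = 1.
Proof.
move=> q0; set x : cell_space D l := repr q.
have qx : q = quo_pi (cell_rad D l) x by rewrite quo_piK.
have [y yx] : exists y, Phi y x <> 0.
  apply: contra_notP q0 => h; rewrite qx; apply/quo_pi_eq0/cell_radP => y.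
  by rewrite Phi_sym; apply: contrapT => yx; apply: h; exists y.
exists x, ((Phi y x)^-1 *: y); split=> //.
by rewrite Phi_sym PhiZr [Phi x y]Phi_sym mulVf //; apply/eqP.
Qed.

Lemma in_X0P l : in_X0 D l <-> nonzero_mod (simple_L D l).
Proof.
split=> [[x [y xy]]|[q /in_X0_nondegenerate[x [y [_ yx]]]]].
  exists (quo_pi (cell_rad D l) x) => /quo_pi_eq0/cell_radP/(_ y); exact: xy.
by exists y, x; rewrite yx; apply/eqP/oner_neq0.
Qed.

(** A rank one element carries a given nonzero class to any prescribed class. *)
Lemma simple_L_simple l : in_X0 D l -> simple_mod (simple_L D l).
Proof.
move=> lX0; split; first exact/in_X0P.
move=> U; have [U0|U0] := pselect (sm_zero U); [by left|right=> q].
have [w wU w0] : exists2 w, w \in U & w <> 0.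
  by apply: contra_notP U0 => h w wU; apply: contrapT => w0; apply: h; exists w.
have [x [y [wx yx]]] := in_X0_nondegenerate w0.
have := sm_act (cell_rank1 (repr q : cell_space D l) y) wU.
rewrite wx act_quo_pi [act _ _]cell_act_rank1 yx scale1r.
by have -> := quo_piK q.
Qed.

(** With [y] pairing to 1 with [u], take k = Phi y v. The rank one element of [x] and [y] fixes [u]
    and kills v - k u, so the hypothesis forces this difference to be 0. *)
Lemma simple_L_scalar l (u v : simple_L D l) : u <> 0 ->
    (forall k a, v - k *: u <> 0 -> act a (v - k *: u) = 0 -> act a u = 0) ->
  exists k, v = k *: u.
Proof.
move=> u0 h; have [x [y [ux yx]]] := in_X0_nondegenerate u0.
set z : cell_space D l := repr v.
have vz : v = quo_pi (cell_rad D l) z by rewrite quo_piK.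
exists (Phi y z); apply: subr0_eq; apply: contrapT => w0; apply: u0.
have := h _ (cell_rank1 x y) w0.
have -> : v - Phi y z *: u = quo_pi (cell_rad D l) (- Phi y z *: x + z).
  by rewrite quo_piP_lin -ux -vz scaleNr addrC.
rewrite act_quo_pi [act _ _]cell_act_rank1 Phi_linr yx mulr1 addNr scale0r.
rewrite ux act_quo_pi [act _ _]cell_act_rank1 yx scale1r; apply.
exact/quo_pi_eq0/sm0.
Qed.

End Cells.

(** * Idempotents that detect a simple module *)

Section Detection.
Variables (K : fieldType) (R : algebra K) (X : finType) (D : cell_datum R X).

Local Notation M := (cd_M D).
Local Notation C := (cd_C D).
Local Notation r := (cd_r D).
Local Notation "a ^!" := (cd_star D a) (at level 1, format "a ^!").
Local Notation eps := (cd_eps D).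
Local Notation epsm := (cd_epsm D).
Local Notation co := (cell_coef (D := D)).
Local Notation piL x := (quo_pi (cell_rad D _) x).

Lemma Rmod_generator (P : lmodule R) (e : R) : lmod_iso P (Rmod e) -> e ** e = e ->
  exists (p : P) (i : {linear P -> R}),
  [/\ injective i, forall a x, i (act a x) = a ** i x, i p = e &
      forall x, exists a, x = act a p].
Proof.
move=> [phi [eqphi [psi phiK psiK]]] ee.
have lin : linear (fun x : P => sub_val (phi x) : R).
  by move=> k x y; rewrite linearP; apply: (linearP (val : Rmod e -> regular R)).
have eRe : (e : regular R) \in left_ideal_pred e by apply/left_idealP; exists e.
pose eU : Rmod e := @SubCar _ _ (regular R)
  (Submodule (@left_ideal_lin _ _ e) (@left_ideal_act _ _ e)) e eRe.
exists (psi eU), (to_linear lin); split=> /=.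
- by move=> x y h; apply: (can_inj phiK); apply: val_inj.
- by move=> a x; rewrite eqphi.
- by rewrite psiK.
move=> x; have /left_idealP[a ha] := sub_valP (phi x).
exists a; apply: (can_inj phiK); rewrite eqphi psiK; apply: val_inj.
exact: ha.
Qed.

(** By [iso_head], a simple module not killed by [e] is the head of [P]. The class of the generator
    gives [u]; the nonzero vectors of e L(l) all have the annihilator of [u], so [simple_L_scalar]
    makes them multiples of [u]. *)
Lemma detects_of_head (P : lmodule R) l (e : R) : in_X0 D l ->
    lmod_iso (Defs.head P) (simple_L D l) -> lmod_iso P (Rmod e) -> e ** e = e ->
  detects e (simple_L D l).
Proof.
move=> lX0 hP Pe ee; have [p [i [inji eqi ip gen]]] := Rmod_generator Pe ee.
have ep : act e p = p by apply: inji; rewrite eqi ip ee.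
have ann a : act a p = 0 -> a ** e = 0 by move=> h; rewrite -ip -eqi h linear0.
have sH := iso_simple (iso_sym hP) (simple_L_simple lX0).
have sL := simple_L_simple lX0.
split=> // [Q sQ x ex0|]; first exact/(iso_trans _ hP)/(iso_head ee ep gen ann sH sQ ex0).
have [phi [eqphi [psi phiK psiK]]] := hP.
have eu : act e (phi (quo_pi (radical P) p)) = phi (quo_pi (radical P) p).
  by rewrite -eqphi act_quo_pi ep.
have u0 : phi (quo_pi (radical P) p) <> 0.
  rewrite -(linear0 phi) => /(can_inj phiK)/quo_pi_eq0; apply/negP.
  exact: (generator_notin_radical gen sH).
move: (phi _) eu u0 => u eu u0; exists u; split=> // v.
apply: simple_L_scalar => // k a; set w := _ - _ => w0 aw0.
have ew : act e w = w by rewrite actBr actZr eu -actM ee.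
(* Both [w] and [u] are fixed by [e], so [a] kills either of them exactly when a p lies in the
   radical. *)
have rad (q : simple_L D l) : act e q <> 0 ->
    act (a ** e) q = 0 <-> act a p \in radical P.
  exact: (radical_annihilator ee ep gen ann sH).
have := rad u; rewrite eu => /(_ u0).
have := rad w; rewrite ew => /(_ w0).
by rewrite !actM eu ew => -[h _] [_]; apply; apply: h.
Qed.

Lemma cell_act_C l (S T : M l) (z : cell_space D l) :
  cell_act (C S T) z = Phi (cell_basis T) z *: cell_basis S.
Proof.
rewrite -cell_act_rank1 /cell_rank1 (bigD1 S) //= (bigD1 T) //= !ffunE !eqxx.
rewrite mulr1 scale1r big1 => [|V /negPf VT]; last first.
  by rewrite !ffunE VT mulr0 scale0r.
rewrite big1 ?addr0 // => V /negPf VS.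
by rewrite big1 // => W _; rewrite !ffunE VS mul0r scale0r.
Qed.

(* If [l] is minimal for the order of [d] among the cells with some [C^l_{S,T}],
   [T] of idempotent [d], not killing [Q], then [m^l_S |-> C^l_{S,T} y] is a
   module map from [Delta(l)] onto [Q]. *)
Lemma simple_complete (Q : lmodule R) d (x : Q) : simple_mod Q ->
  act (eps d) x <> 0 -> exists2 l, in_X0 D l & lmod_iso Q (simple_L D l).
Proof.
move=> sQ ex0.
pose acts l := `[< exists (S T : M l) (y : Q), epsm T = d /\ act (C S T) y <> 0 >].
(* Expanding [eps d] in the cellular basis, some term must act nontrivially on [eps d] x. *)
have [l0 actl0] : exists l, acts l.
  apply: contra_notP ex0 => h; have [_ ee] := cd_eps_idem d.
  rewrite -ee actM {1}(cell_expand D (eps d)) act_suml big1 // => -[l [S T]] _ /=.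
  rewrite actZl -actM; have [Td|Td] := pselect (epsm T = d); last first.
    by rewrite Ceps0 // act0l scaler0.
  have [->|/eqP y0] := eqVneq (act (C S T ** eps d) x) 0; first by rewrite scaler0.
  by case: h; exists l; apply/asboolP; exists S, T, (act (eps d) x); rewrite -actM.
(* Among the cells that act, one with the fewest cells below it is minimal. *)
pose below l := [set m | cd_lt D d m l].
have [l /asboolP[S [T [y0 [Td y00]]]] minl] :
    exists2 l, acts l & forall m, acts m -> ~~ cd_lt D d m l.
  case: (@arg_minnP _ l0 acts (fun l => #|below l|) actl0) => l actl minl.
  exists l => // m /minl; apply: contraTN => ml; rewrite -ltnNge.
  apply: proper_card; apply/properP; split.
    by apply/fintype.subsetP => n; rewrite !inE => nm; apply: cd_lt_trans ml.
  by exists m; rewrite inE // cd_lt_irr.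
(* The error terms of [cd_mulC] vanish on [Q] by minimality, so [psi] commutes with the action. *)
have low (y : R) (q : Q) : cell_span (@cd_C _ _ _ D) (fun m => cd_lt D d m l) y ->
    act (y ** eps d) q = 0.
  move: y; apply: span_ind => [|k a b ha hb|_ [m [U [V [ml ->]]]]].
  - by rewrite amul0l act0l.
  - by rewrite amulDl amulZl actDl actZl ha hb scaler0 addr0.
  have [Vd|Vd] := pselect (epsm V = d); last by rewrite Ceps0 // act0l.
  rewrite Ceps1 //; apply: contrapT => UVq.
  by have /minl/negP : acts m by apply/asboolP; exists U, V, q.
pose psi (z : cell_space D l) : Q := \sum_S z S *: act (C S T) y0.
have psiP k (z w : cell_space D l) : psi (k *: z + w) = k *: psi z + psi w.
  rewrite /psi scaler_sumr -big_split; apply: eq_bigr => U _ /=.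
  by rewrite !ffunE scalerDl scalerA.
have psi0 : psi 0 = 0 by rewrite /psi big1 // => U _; rewrite ffunE scale0r.
have psiZ k (z : cell_space D l) : psi (k *: z) = k *: psi z.
  by rewrite -[_ *: z]addr0 psiP psi0 addr0.
have psiA a (z : cell_space D l) : psi (cell_act a z) = act a (psi z).
  transitivity (\sum_U z U *: act (a ** C U T) y0).
    rewrite /psi; under eq_bigr do rewrite ffunE scaler_suml.
    rewrite exchange_big; apply: eq_bigr => U _ /=.
    have [y hy ->] := cd_mulC U T a; rewrite Td in hy *.
    rewrite actDl low // addr0 act_suml scaler_sumr; apply: eq_bigr => V _.
    by rewrite actZl scalerA.
  rewrite /psi; elim/big_rec2: _ => [|U w v _ ->]; first by rewrite act0r.
  by rewrite actDr actZr actM.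
have psiS : psi (cell_basis S) = act (C S T) y0.
  rewrite /psi (bigD1 S) //= ffunE eqxx scale1r big1 ?addr0 // => U /negPf US.
  by rewrite ffunE US scale0r.
have image (W : submodule (Delta D l)) : exists V : submodule Q,
    forall q, q \in V <-> exists2 z, z \in W & q = psi z.
  apply: closed_submodule; first by exists 0; rewrite ?sm0.
    move=> k _ _ [z zW ->] [w wW ->]; exists (k *: z + w); last by rewrite psiP.
    by apply: smD => //; apply: smZ.
  by move=> a _ [z zW ->]; exists (act a z); [apply: sm_act|exact/esym/psiA].
have Phi0 z : y0 = psi z -> Phi (cell_basis T) z <> 0.
  move=> yz h; apply: y00; rewrite {1}yz -psiA cell_act_C h scale0r.
  exact: psi0.
have sur q : exists z, q = psi z.
  have [F Ffull] := full_submodule (Delta D l); have [V hV] := image F.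
  have [V0|V1] := sQ.2 V; last by have /hV[z _ ->] := V1 q; exists z.
  by case: y00; rewrite -psiS; apply: V0; apply/hV; exists (cell_basis S).
(* Outside the radical, a rank one element moves [z] to m_S, which [psi] does not kill. Conversely
   the image of the radical is 0 or [Q], and by [Phi0] it misses [y0]. *)
have radE z : psi z = 0 <-> z \in cell_rad D l.
  split=> [z0|zrad].
    apply: contrapT => zrad.
    have [] := @in_X0_nondegenerate _ _ _ D l (piL z); first by move/quo_pi_eq0.
    move=> z' [y [/quo_piP zz' yz']]; apply: y00; rewrite -psiS.
    have : Phi y z = 1.
      rewrite -yz'; apply: subr0_eq; rewrite -PhiBr Phi_sym.
      by have /cell_radP := zz'; apply.
    by move=> yz; rewrite -[cell_basis S]scale1r -yz -cell_act_rank1 psiA z0 act0r.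
  have [V hV] := image (cell_rad D l).
  have [V0|V1] := sQ.2 V; first by apply/V0/hV; exists z.
  have /hV[w /cell_radP wrad /Phi0] := V1 y0.
  by rewrite Phi_sym wrad.
have [z0 yz0] := sur y0.
exists l; first by exists (cell_basis T), z0; apply: Phi0.
apply/iso_sym/(@iso_of_rel _ _ (simple_L D l) Q
  (fun q w => exists2 z, q = piL z & w = psi z)).
- move=> k _ _ _ _ [z -> ->] [w -> ->]; exists (k *: z + w); last by rewrite psiP.
  by rewrite quo_piP_lin.
- by move=> a _ _ [z -> ->]; exists (act a z); [rewrite act_quo_pi|exact/esym/psiA].
- by move=> q; exists (psi (repr q)), (repr q); rewrite // quo_piK.
- by move=> w; have [z ->] := sur w; exists (piL z), z.
- by move=> w [z /esym/quo_pi_eq0/radE ? ->].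
- by move=> q [z -> /esym/radE/quo_pi_eq0].
Qed.

Lemma Phi_pi l (x y z : cell_space D l) :
  quo_pi (cell_rad D l) x = quo_pi (cell_rad D l) y -> Phi z x = Phi z y.
Proof.
move=> /quo_piP/cell_radP h; apply: subr0_eq.
by rewrite -PhiBr Phi_sym h.
Qed.

(** Adjunction moves [e^!] across the form: if [e^!] is nonzero on L(m), so is [e], and on L(l) the
    image of [e^!] is a line since that of [e] is. That an arbitrary simple module is some L(m)
    comes from [simple_complete], which applies because [eps d ** e^! = e^!]. *)
Lemma detects_star l (e : R) d : in_X0 D l -> e ** eps d = e ->
  detects e (simple_L D l) -> detects e^! (simple_L D l).
Proof.
move=> lX0 ed [ee det [u [u0 eu uP]]].
have see : e^! ** e^! = e^! by rewrite -cd_starM ee.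
split=> // [Q sQ x ex0|].
  have [m mX0 /[dup] isoQ [phi [eqphi [psi phiK psiK]]]] :
      exists2 m, in_X0 D m & lmod_iso Q (simple_L D m).
    apply: (@simple_complete Q d (act e^! x)) => //.
    by rewrite -actM -cd_eps_star -cd_starM ed.
  apply: iso_trans isoQ _.
  set z : cell_space D m := repr (phi x).
  have phix : phi x = piL z by rewrite quo_piK.
  have [] := @in_X0_nondegenerate _ _ _ D m (act e^! (phi x)).
    by rewrite -eqphi -(linear0 phi) => /(can_inj phiK).
  move=> w [y []]; rewrite phix act_quo_pi => /Phi_pi - /(_ y) <-.
  rewrite -[act _ _]/(cell_act _ _) -Phi_adj => h.
  apply: (det _ (simple_L_simple mX0) (piL y)).
  rewrite act_quo_pi => /quo_pi_eq0/cell_radP/(_ z) h0.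
  by have /eqP := oner_neq0 K; rewrite -h [Phi _ _]h0.
have [x [y1 [ux y1x]]] := in_X0_nondegenerate u0.
have exx y : Phi y (cell_act e x) = Phi y x.
  apply: Phi_pi.
  by rewrite -ux -[in RHS]eu ux act_quo_pi.
(* The vectors e x and x have the same class, so [e^!] y1 pairs to Phi y1 x = 1 with x and is
   nonzero in L(l). *)
exists (act e^! (piL y1 : simple_L D l)); split.
- rewrite act_quo_pi => /quo_pi_eq0/cell_radP/(_ x).
  by rewrite [Phi _ _]Phi_adj cd_starK exx y1x; apply/eqP/oner_neq0.
- by rewrite -actM see.
move=> v; set y : cell_space D l := repr v.
have -> : v = piL y by rewrite quo_piK.
(* The scalar is read off by pairing with [x]: the image of [e] is spanned by the class of [x], and
   y - Phi y x *: y1 is orthogonal to [x]. *)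
exists (Phi y x); rewrite -actZr; apply: subr0_eq.
have -> : act e^! (piL y : simple_L D l) - act e^! (Phi y x *: (piL y1 : simple_L D l)) =
    piL (act e^! (- Phi y x *: y1 + y : Delta D l)).
  by rewrite -act_quo_pi quo_piP_lin actDr !actZr scaleNr addrC.
apply/quo_pi_eq0/cell_radP => z; rewrite [Phi _ _]Phi_adj cd_starK.
have [k] := uP (piL z); rewrite act_quo_pi ux -quo_piZ => /Phi_pi ->.
by rewrite PhiZr Phi_lin y1x mulr1 addNr mulr0.
Qed.

End Detection.

(** * Cells met by [e] and by two-sided products with [e] *)

Section Support.
Variables (K : fieldType) (R : algebra K) (X : finType) (D : cell_datum R X).

Local Notation M := (cd_M D).
Local Notation C := (cd_C D).
Local Notation r := (cd_r D).
Local Notation "a ^!" := (cd_star D a) (at level 1, format "a ^!").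
Local Notation eps := (cd_eps D).
Local Notation epsm := (cd_epsm D).
Local Notation co := (cell_coef (D := D)).
Local Notation cell_index := {l : X & (M l * M l)%type}.

(** Identifies [R], an [lmodType], with a [vectType] in which dimensions are measured. *)
Definition cell_coords (a : R) : {ffun cell_index -> K^o} :=
  [ffun i : cell_index => co (tagged i).1 (tagged i).2 a].

Lemma cell_coords_lin : linear cell_coords.
Proof. by move=> k a b; apply/ffunP => i; rewrite !ffunE co_lin. Qed.

Lemma cell_coords_inj : injective cell_coords.
Proof.
move=> a b ab; apply: (cell_coef_eq (D := D)) => l S T.
have := congr1 (fun v : {ffun _ -> _} => v (existT _ l (S, T))) ab.
by rewrite !ffunE.
Qed.

Lemma cell_coords_surj (v : {ffun cell_index -> K^o}) : exists a, v = cell_coords a.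
Proof.
exists (\sum_(i : cell_index) v i *: C (tagged i).1 (tagged i).2).
apply/ffunP => -[l [S T]]; rewrite ffunE /= co_sum (bigD1 (existT _ l (S, T))) //=.
rewrite coZ coC !eqxx mulr1 big1 ?addr0 // => -[m [P Q]] /=.
have [ml|ml _] := eqVneq m l; last by rewrite coZ coC_neq ?mulr0.
move: P Q; rewrite ml => P Q; rewrite -tag_eqE /tag_eq /= eqxx tagged_asE xpair_eqE.
by rewrite coZ coC [S == P]eq_sym [T == Q]eq_sym /= => /negPf ->; rewrite mulr0.
Qed.

(** By finite dimension [U] lies in a maximal submodule. That one contains the radical, which is
    maximal too as the head is simple, so they coincide. *)
Lemma proper_le_radical (N : lmodule R) (V : vectType K) (g : {linear N -> V})
    (U : submodule N) : injective g ->
  simple_mod (Defs.head N) -> ~ sm_full U -> sm_le U (radical N).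
Proof.
move=> inj_g sH Unf; have [_ maxrad] := simple_quo_maximal sH.
have [W [UW Wnf] maxW] : exists2 W : submodule N, sm_le U W /\ ~ sm_full W &
    forall T : submodule N, sm_le U T /\ ~ sm_full T -> sm_le W T -> sm_le T W.
  by apply: (exists_maximal inj_g); exists U; split.
have mW : maximal_sm W.
  split=> // T WT; have [fT|fT] := pselect (sm_full T); [by left|right].
  by apply: maxW => //; split=> // x /UW/WT.
have [//|Wrad] := maxrad W (fun x xr => elimT (radicalP x) xr W mW).
by move=> x /UW/Wrad.
Qed.

(** The entry is a coefficient, in cell [m], of C P Q ** C S S, and [Cmul] bounds the cells of this
    product by [l] in the order attached to [P]. *)
Lemma cd_r_C_le l m (S' S : M m) (P Q : M l) :
  r (C P Q) S' S <> 0 -> cell_le (epsm P) m l.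
Proof.
apply: contra_notT; rewrite negb_or => /andP[ml ltml].
rewrite (cd_r_co S S' S); have [y hy ->] := Cmul P Q (C S S).
rewrite coD (co_eps_span _ _ _ _ hy) // addr0 co_sum.
by rewrite big1 // => V _; rewrite coZ coC_neq ?mulr0 1?eq_sym.
Qed.

(* [e] lies in the two-sided ideal of [eps d R eps d] spanned by the
   [C^m_{S,T}] with [m <= l]: a rank one element of the cell of [l] acts on
   [L(l)] as [e] does, hence generates [R e] as a left module. *)
Lemma head_support (P : lmodule R) l d (e : R) m (S S' : M m) : in_X0 D l ->
    lmod_iso (Defs.head P) (simple_L D l) -> lmod_iso P (Rmod e) ->
    e ** e = e -> eps d ** e = e -> e ** eps d = e ->
  r e S' S <> 0 -> cell_le d m l.
Proof.
move=> lX0 hP Pe ee de ed re; have [p [i [inji eqi ip gen]]] := Rmod_generator Pe ee.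
have ep : act e p = p by apply: inji; rewrite eqi ip ee.
have sH := iso_simple (iso_sym hP) (simple_L_simple lX0).
have [phi [eqphi [psi phiK psiK]]] := hP.
set u := phi (quo_pi (radical P) p).
have u0 : u <> 0.
  rewrite -(linear0 phi) => /(can_inj phiK)/quo_pi_eq0; apply/negP.
  exact: (generator_notin_radical gen sH).
have eu : act e u = u by rewrite -eqphi act_quo_pi ep.
have [x [y [ux yx]]] := in_X0_nondegenerate u0.
(* A rank one element of the cell [l], cut down by [e] on both sides, that still fixes [u]. *)
pose a := e ** cell_rank1 x y ** e.
have ae : a ** e = a by rewrite -amulA ee.
have au : act a u = u.
  rewrite !actM eu {1}ux (act_quo_pi _ (cell_rank1 x y)).
  rewrite [act (cell_rank1 _ _) _]cell_act_rank1 yx scale1r.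
  by rewrite -ux eu.
have [U hU] : exists U : submodule P, forall q, q \in U <-> exists b, q = act b (act a p).
  apply: closed_submodule; first by exists 0; rewrite act0l.
    move=> k _ _ [b ->] [c ->]; exists (k *: b + c).
    by rewrite actDl actZl.
  by move=> c _ [b ->]; exists (c ** b); rewrite actM.
pose g := to_linear cell_coords_lin \o i : {linear P -> _}.
(* Since [a] u = u is nonzero, a p lies outside the radical and generates [P]. *)
have Ufull : sm_full U.
  apply: contrapT => /(@proper_le_radical _ _ g) h.
  have /quo_pi_eq0 h0 : act a p \in radical P.
    apply: h => //; first by move=> q q' /cell_coords_inj/inji.
    apply/hU; exists e; rewrite -actM /a !amulA ee //.
  by apply: u0; rewrite -au -eqphi act_quo_pi h0 linear0.
have /hU[b pb] := Ufull p.
have {pb} eb : e = b ** a by rewrite -ip {1}pb !eqi ip ae.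
(* The identity e = b a is rewritten as e = z e, with [z] a multiple of the rank one element by a
   factor in eps d R eps d. *)
pose b' := e ** b ** e; pose z := b' ** cell_rank1 x y.
have ez : e = z ** e.
  by rewrite /z /b' -{1}ee {2}eb /a !amulA.
have zd : eps d ** z = z by rewrite /z /b' !amulA de.
have b'd : b' = eps d ** b' ** eps d.
  by rewrite /b' !amulA de -!amulA ed.
(* Axiom [cd_eCe]: left multiplication by eps d R eps d stays in the cells up to [l] for [d],
   whatever the right index. *)
have zl n (T T' : M n) : ~~ cell_le d n l -> co T T' z = 0.
  move=> nl; rewrite /z /cell_rank1 amul_sumr co_sum big1 // => V _.
  rewrite amul_sumr co_sum big1 // => W _; rewrite amulZr coZ b'd.
  rewrite (@co_span _ _ _ D _ _ _ (cell_le d ^~ l) _ nl) ?mulr0 //.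
  exact: cd_eCe.
(* It suffices that [z] is zero on Delta(m): its terms lie in cells n <= l with left index of
   idempotent [d], and act nontrivially only if m <= n. *)
apply: contrapT => nle; apply: re; rewrite ez cd_rM big1 // => T _.
suff -> : r z S' T = 0 by rewrite mul0r.
rewrite (cell_expand D z) cd_r_sum big1 // => -[n [V W]] _ /=; rewrite cd_rZ.
have [Vd|Vd] := pselect (epsm V = d); last by rewrite (co_eps_l _ zd) ?mul0r.
have [nl|nl] := boolP (cell_le d n l); last by rewrite zl ?mul0r.
have [->|/eqP/cd_r_C_le] := eqVneq (r (C V W) S' T) 0; first by rewrite mulr0.
rewrite Vd => mn; case: nle; move: mn nl => /orP[/eqP -> //|mn].
by move=> /orP[/eqP <-|nl]; apply/orP; right => //; apply: cd_lt_trans nl.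
Qed.

(** In [cd_mulC] the governing order is that of the right index, which is [d] for every basis
    element kept by [eps d]; down-closed sets of cells for [d] are therefore preserved. *)
Lemma co_mul_span_eps d (P : pred X) l (S T : M l) y a : ~~ P l ->
    (forall m n, P m -> cd_lt D d n m -> P n) ->
  cell_span (@cd_C _ _ _ D) P y -> co S T (a ** (y ** eps d)) = 0.
Proof.
move=> Pl Pdown; move: y; apply: span_ind => [|k u v hu hv|_ [m [U [V [Pm ->]]]]].
- by rewrite amul0l amul0r co0.
- by rewrite amulDl amulZl amulDr amulZr co_lin hu hv mulr0 addr0.
have [Vd|Vd] := pselect (epsm V = d); last by rewrite Ceps0 // amul0r co0.
rewrite Ceps1 //; apply: co_mulC_neq; last by apply: contraNneq Pl => <-.
by rewrite Vd; apply: contra Pl; apply: Pdown.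
Qed.

Lemma cell_le_down d l m n : cell_le d m l -> cd_lt D d n m -> cell_le d n l.
Proof.
by move=> /orP[/eqP <-|ml] nm; apply/orP; right=> //; apply: cd_lt_trans ml.
Qed.

Section TwoSided.
Variables (d : cd_E D) (e : R).
Hypotheses (de : eps d ** e = e) (ed : e ** eps d = e).

Lemma star_de : e^! ** eps d = e^!.
Proof. by rewrite -cd_eps_star -cd_starM de. Qed.
Lemma star_ed : eps d ** e^! = e^!.
Proof. by rewrite -cd_eps_star -cd_starM ed. Qed.

(** The starred product is [e^!] times C T S with [e^!] in eps d R eps d, so [cd_eCe] gives a bound
    for [d], whereas [Cmul] gives one for the order of [S]. *)
Lemma Cmul_span l (S T : M l) : cell_span (@cd_C _ _ _ D) (cell_le d ^~ l) (C S T ** e).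
Proof.
apply: cell_coef_span => m U V ml.
rewrite -[_ ** _](cd_starK D) co_star cd_starM cd_starC -star_de -star_ed.
exact/co_span/cd_eCe.
Qed.

Lemma co_two_sided_lt f l m (S T : M l) (S' T' : M m) :
  ~~ cell_le d m l -> co S' T' (f ** C S T ** e) = 0.
Proof.
move=> ml; rewrite -amulA -ed [C S T ** _]amulA.
apply: co_mul_span_eps (Cmul_span S T) => //.
exact: cell_le_down.
Qed.

(** Up to cells strictly below [l] for [d], C S T ** e is [y]. Both lie in R eps d, so left
    multiplication by [f] keeps the error below [l]; what remains is [f] on the left index and [e^!]
    on the right one. *)
Lemma co_two_sided f l (S T S' T' : M l) :
  co S' T' (f ** C S T ** e) = r f S' S * r e^! T' T.
Proof.
pose y := \sum_V r e^! V T *: C S V.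
(* Only right indices of idempotent [d] occur in [y], because [eps d ** e^! = e^!]. *)
have yd : y ** eps d = y.
  rewrite amul_suml; apply: eq_bigr => V _; rewrite amulZl.
  have [Vd|Vd] := pselect (epsm V = d); first by rewrite Ceps1.
  by rewrite (cd_r_eps_l _ star_ed) // !scale0r.
have hz : cell_span (@cd_C _ _ _ D) (cd_lt D d ^~ l) (- 1 *: y + C S T ** e).
  apply: cell_coef_span => m U V ml; rewrite co_lin.
  have [lm|lm] := eqVneq m l; last first.
    rewrite (co_span _ _ _ (Cmul_span S T)) ?negb_or ?lm // addr0.
    rewrite /y co_sum big1 ?mulr0 // => W _.
    by rewrite coZ coC_neq ?mulr0 1?eq_sym.
  move: U V; rewrite lm => U V.
  rewrite -[C S T ** e](cd_starK D) co_star cd_starM cd_starC co_mulC.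
  rewrite /y co_sum (bigD1 V) //= coZ coC eqxx andbT big1 => [|W /negPf WV].
    by rewrite addr0 mulN1r [r _ _ _ * _]mulrC addNr.
  by rewrite coZ coC [V == W]eq_sym WV andbF mulr0.
have : co S' T' (f ** ((- 1 *: y + C S T ** e) ** eps d)) = 0.
  apply: co_mul_span_eps hz; first by rewrite cd_lt_irr.
  by move=> m n ml nm; apply: cd_lt_trans ml.
rewrite amulDl amulZl yd -[_ ** e ** _]amulA ed amulDr amulZr co_lin mulN1r.
rewrite amulA addrC => /subr0_eq ->; rewrite amul_sumr co_sum.
rewrite (bigD1 T') //= amulZr coZ co_mulC eqxx mul1r big1 ?addr0 1?mulrC //.
by move=> V /negPf VT; rewrite amulZr coZ co_mulC eq_sym VT mul0r mulr0.
Qed.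

End TwoSided.

End Support.

(** * Ranks of matrices indexed by finite types *)

Section MatrixRank.
Variable K : fieldType.

(** Arbitrary finite index types spare the renumbering of blocks and products; for the matrix of an
    element of [R] on a cell module this is [cell_act]. *)
Definition mat_fun (I : finType) (a : I -> I -> K) (x : {ffun I -> K^o}) :
  {ffun I -> K^o} := [ffun i => \sum_j x j * a i j].

Definition mat_rank (I : finType) (a : I -> I -> K) : nat :=
  \dim (limg (linfun (mat_fun a))).

Lemma mat_fun_lin (I : finType) (a : I -> I -> K) : linear (mat_fun a).
Proof.
move=> k x y; apply/ffunP => i; rewrite !ffunE scaler_sumr -big_split.
by apply: eq_bigr => j _; rewrite !ffunE mulrDl /GRing.scale /= mulrA.
Qed.

Lemma mat_rankP (I : finType) (a : I -> I -> K) (E : {vspace {ffun I -> K^o}}) :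
  (forall v, v \in E <-> exists x, v = mat_fun a x) -> mat_rank a = \dim E.
Proof.
move=> hE; congr (\dim _); apply/vspaceP => v.
by apply/idP/idP => [/(limg_linfunP (mat_fun_lin a))/hE|/hE h];
  last exact/(limg_linfunP (mat_fun_lin a)).
Qed.

Lemma mat_fun_delta (I : finType) (a : I -> I -> K) (i : I) :
  mat_fun a [ffun j => (j == i)%:R] = [ffun j => a j i].
Proof.
apply/ffunP => j; rewrite !ffunE (bigD1 i) //= ffunE eqxx mul1r big1 ?addr0 //.
by move=> k /negPf ki; rewrite ffunE ki mul0r.
Qed.

(** The image is spanned by the products of basis vectors of the two images. The map [h] sends a
    coefficient matrix to the corresponding combination, injectively since both bases are free. *)
Lemma mat_rank_tensor (I J : finType) (a : I -> I -> K) (b : J -> J -> K) :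
  mat_rank (fun i j : I * J => a i.1 j.1 * b i.2 j.2) = (mat_rank a * mat_rank b)%N.
Proof.
pose t (i j : I * J) := a i.1 j.1 * b i.2 j.2.
pose tens (x : {ffun I -> K^o}) (y : {ffun J -> K^o}) : {ffun I * J -> K^o} :=
  [ffun i => x i.1 * y i.2].
set U := limg (linfun (mat_fun a)); set W := limg (linfun (mat_fun b)).
pose h (N : 'M[K]_(\dim U, \dim W)) : {ffun I * J -> K^o} :=
  \sum_k \sum_l N k l *: tens (vbasis U)`_k (vbasis W)`_l.
have hlin : linear h.
  move=> c N N'; rewrite /h scaler_sumr -big_split; apply: eq_bigr => k _.
  rewrite scaler_sumr -big_split; apply: eq_bigr => l _ /=.
  by rewrite !mxE scalerDl scalerA.
have hE N : linfun h N = h N := lfunE (to_linear hlin) N.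
have hinj : lker (linfun h) == 0%VS.
  rewrite -subv0; apply/subvP => N; rewrite memv_ker hE memv0 => /eqP hN.
  have freeU : free (vbasis U) by apply/basis_free/vbasisP.
  have freeW : free (vbasis W) by apply/basis_free/vbasisP.
  apply/eqP/matrixP => k l; rewrite mxE.
  move/freeP: freeW => /(_ (fun l => N k l)); apply; apply/ffunP => j.
  rewrite sum_ffunE ffunE.
  (* The coefficient of the k-th basis vector of [U] in the slice of h N at [j]. *)
  pose c k := \sum_l N k l * (vbasis W)`_l j.
  transitivity (c k); first by apply: eq_bigr => l' _; rewrite ffunE.
  move/freeP: freeU => /(_ c); apply; apply/ffunP => i.
  have := congr1 (fun v : {ffun _ -> _} => v (i, j)) hN.
  rewrite /h !sum_ffunE !ffunE => {2}<-; apply: eq_bigr => k' _.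
  rewrite ffunE sum_ffunE /c /GRing.scale /= mulr_suml; apply: eq_bigr => l' _.
  by rewrite !ffunE /GRing.scale /= -mulrA; congr (_ * _); rewrite mulrC.
have hdim : \dim (limg (linfun h)) = (\dim U * \dim W)%N.
  rewrite limg_dim_eq; last by rewrite (eqP hinj) capv0.
  by rewrite dimvf /dim.
transitivity (\dim (limg (linfun h))); last exact: hdim.
apply: mat_rankP => v.
have htens x y : x \in U -> y \in W -> tens x y \in limg (linfun h).
  move=> xU yW; apply/(limg_linfunP hlin).
  exists (\matrix_(k, l) (coord (vbasis U) k x * coord (vbasis W) l y)).
  apply/ffunP => i; rewrite !ffunE.
  rewrite {1}(coord_vbasis xU) {1}(coord_vbasis yW) !sum_ffunE mulr_suml.
  apply: eq_bigr => k _; rewrite sum_ffunE mulr_sumr; apply: eq_bigr => l _.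
  by rewrite !ffunE mxE /GRing.scale /= mulrACA.
have tensE x y : mat_fun t (tens x y) = tens (mat_fun a x) (mat_fun b y).
  apply/ffunP => i; rewrite !ffunE mulr_suml.
  transitivity (\sum_k \sum_l tens x y (k, l) * t i (k, l)).
    by rewrite pair_bigA; apply: eq_bigr => -[].
  apply: eq_bigr => k _; rewrite mulr_sumr; apply: eq_bigr => l _.
  by rewrite ffunE /t /= mulrACA.
have hU x : mat_fun a x \in U by apply/(limg_linfunP (mat_fun_lin a)); exists x.
have hW y : mat_fun b y \in W by apply/(limg_linfunP (mat_fun_lin b)); exists y.
split=> [/(limg_linfunP hlin)[N ->]|[x ->]].
  apply/(limg_linfunP (mat_fun_lin t))/rpred_sum => k _; apply/rpred_sum => l _.
  apply/rpredZ/(limg_linfunP (mat_fun_lin t)).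
  have /(limg_linfunP (mat_fun_lin a))[x ->] : (vbasis U)`_k \in U.
    by apply/vbasis_mem/mem_nth; rewrite size_tuple.
  have /(limg_linfunP (mat_fun_lin b))[y ->] : (vbasis W)`_l \in W.
    by apply/vbasis_mem/mem_nth; rewrite size_tuple.
  by exists (tens x y); rewrite tensE.
have -> : mat_fun t x = \sum_i x i *: tens (mat_fun a [ffun j => (j == i.1)%:R])
    (mat_fun b [ffun j => (j == i.2)%:R]).
  apply/ffunP => i; rewrite ffunE sum_ffunE; apply: eq_bigr => j _.
  by rewrite !mat_fun_delta !ffunE.
by apply: rpred_sum => i _; apply/rpredZ/htens.
Qed.

(** * Block triangular idempotents *)

Section BlockTriangular.
Variables (X : finType) (lt : rel X) (I : X -> finType).
Hypotheses (lt_irr : irreflexive lt) (lt_trans : transitive lt).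
Local Notation J := {l : X & I l}.
Variable t : J -> J -> K.
Hypothesis t_idem : forall v, mat_fun t (mat_fun t v) = mat_fun t v.
Hypothesis t_tri : forall i j, ~~ ((tag i == tag j) || lt (tag i) (tag j)) -> t i j = 0.

(** Induction on a down-closed set [A] of blocks, for the image of the vectors supported on [A]: a
    maximal block [l] is split off by restricting to it. *)
Lemma mat_rank_block_triangular :
  mat_rank t =
  (\sum_l mat_rank (fun i j : I l => t (Tagged I i) (Tagged I j)))%N.
Proof.
pose supp (A : {set X}) (w : {ffun J -> K^o}) := forall i, tag i \notin A -> w i = 0.
suff step n (A : {set X}) (E : {vspace {ffun J -> K^o}}) : #|A| = n ->
    (forall l m, l \in A -> lt m l -> m \in A) ->
    (forall v, v \in E <-> exists2 w, supp A w & v = mat_fun t w) ->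
    \dim E = (\sum_(l in A) mat_rank (fun i j : I l => t (Tagged I i) (Tagged I j)))%N.
  rewrite {1}/mat_rank (step _ [set: X] _ erefl) => [|//|v].
    by apply: eq_bigl => l; rewrite inE.
  split=> [/(limg_linfunP (mat_fun_lin t))[w ->]|[w _ ->]].
    by exists w => // i; rewrite inE.
  by apply/(limg_linfunP (mat_fun_lin t)); exists w.
elim: n A E => [|n IH] A E cA down hE.
  rewrite (cards0_eq cA) big_set0; apply/eqP; rewrite dimv_eq0 -subv0.
  apply/subvP => v /hE[w w0 ->]; rewrite memv0; apply/eqP/ffunP => i.
  by rewrite !ffunE big1 // => j _; rewrite w0 ?mul0r // (cards0_eq cA) inE.
have [l0 l0A] : exists l, l \in A by apply/set0Pn; rewrite -card_gt0 cA.
pose below l := [set m | lt m l].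
(* An element of [A] with the most elements below it is maximal in [A]. *)
have [l lA maxl] : exists2 l, l \in A & forall m, m \in A -> ~~ lt l m.
  case: (@arg_maxnP _ l0 (mem A) (fun l => #|below l|) l0A) => l lA maxl.
  exists l => // m /maxl; apply: contraTN => lm; rewrite -ltnNge.
  apply: proper_card; apply/properP; split.
    by apply/fintype.subsetP => k; rewrite !inE => kl; apply: lt_trans lm.
  by exists l; rewrite inE // lt_irr.
have [E' hE'] : exists E' : {vspace {ffun J -> K^o}},
    forall v, v \in E' <-> exists2 w, supp (A :\ l) w & v = mat_fun t w.
  apply: closed_vspace.
    exists 0; first by move=> i _; rewrite ffunE.
    exact/esym/(linear0 (to_linear (mat_fun_lin t))).
  move=> k _ _ [x hx ->] [y hy ->]; exists (k *: x + y); last by rewrite mat_fun_lin.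
  by move=> i iA; rewrite !ffunE hx // hy // addr0 scaler0.
pose res (v : {ffun J -> K^o}) : {ffun I l -> K^o} := [ffun i => v (Tagged I i)].
have reslin : linear res by move=> k x y; apply/ffunP => i; rewrite !ffunE.
have resE v : linfun res v = res v := lfunE (to_linear reslin) v.
(* As [l] is maximal in [A], the rows of block [l] meet no other block of [A]. *)
have rest w : supp A w -> res (mat_fun t w) =
    mat_fun (fun i j : I l => t (Tagged I i) (Tagged I j)) (res w).
  move=> wA; apply/ffunP => i; rewrite !ffunE.
  transitivity (\sum_m \sum_(j : I m) w (Tagged I j) * t (Tagged I i) (Tagged I j)).
    by rewrite sig_big_dep; apply: eq_bigr => -[].
  rewrite (bigD1 l) //= [X in _ + X]big1 ?addr0.
    by apply: eq_bigr => j _; rewrite ffunE.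
  move=> m ml; rewrite big1 // => j _.
  have [mA|mA] := boolP (m \in A); last by rewrite wA ?mul0r.
  by rewrite t_tri ?mulr0 //= negb_or eq_sym ml maxl.
have suppt w : supp A w -> supp A (mat_fun t w).
  move=> wA i iA; rewrite ffunE big1 // => j _.
  have [jA|jA] := boolP (tag j \in A); last by rewrite wA ?mul0r.
  rewrite t_tri ?mulr0 // negb_or; apply/andP; split.
    by apply: contraNneq iA => ->.
  by apply: contra iA; apply: down.
(* The restriction to block [l] has as image that of the diagonal block, and as kernel the space
   [E'] of the remaining blocks. *)
rewrite -(limg_ker_dim (linfun res) E) (big_setD1 l) //= addnC; congr (_ + _)%N.
  apply/esym/mat_rankP => v; split=> [/memv_imgP[u /hE[w wA ->] ->]|[x ->]].
    by exists (res w); rewrite resE rest.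
  pose w : {ffun J -> K^o} := [ffun i => untag 0 (fun j : I l => x j) i].
  have wA : supp A w.
    move=> i iA; rewrite ffunE untag_dflt //.
    by apply: contraNneq iA => ->.
  have resw : res w = x.
    apply/ffunP => i.
    by rewrite !ffunE (untagE _ _ (erefl : tag (Tagged I i) = l)).
  rewrite -[x]resw -rest // -resE; apply/memv_img/hE; by exists w.
rewrite -(IH _ E') //; last 2 first.
- by apply/eqP; rewrite -eqSS -cA (cardsD1 l A) lA.
- move=> k m /setD1P[kl kA] mk; apply/setD1P; split; last exact: down mk.
  by apply: contraTneq mk => ->; apply: maxl.
congr (\dim _); apply/vspaceP => v; rewrite memv_cap memv_ker resE.
apply/andP/idP => [[/hE[w wA vE] /eqP res0]|/hE'[w wA ->]].
  (* Idempotence enters here: [v] is its own preimage, and it vanishes on block [l]. *)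
  apply/hE'; exists v; last by rewrite vE t_idem.
  move=> i; rewrite !inE negb_and negbK => /orP[/eqP il|]; last first.
    by rewrite vE; apply: suppt.
  case: i il => m i /= ml; move: i; rewrite ml => i.
  by have := congr1 (fun u : {ffun _ -> _} => u i) res0; rewrite !ffunE.
have wA' : supp A w by move=> i iA; apply: wA; rewrite inE negb_and iA orbT.
split; first by apply/hE; exists w.
rewrite rest //; apply/eqP.
have -> : res w = 0 by apply/ffunP => i; rewrite !ffunE wA // !inE eqxx.
exact: (linear0 (to_linear (mat_fun_lin _))).
Qed.

End BlockTriangular.
End MatrixRank.

(** * Multiplicities in cell modules and in projectives *)

Section Multiplicities.
Variables (K : fieldType) (R : algebra K) (X : finType) (D : cell_datum R X).

Local Notation C := (cd_C D).
Local Notation "a ^!" := (cd_star D a) (at level 1, format "a ^!").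
Local Notation eps := (cd_eps D).

Definition cell_mx (a : R) (n : X) (S' S : cd_M D n) : K := cd_r D a S' S.

Lemma JHmult_Delta n l e : detects e (simple_L D l) ->
  JHmult (Delta D n) (simple_L D l) = mat_rank (cell_mx e (n := n)).
Proof.
move=> det; pose g : {linear Delta D n -> cell_space D n} := idfun.
apply: (JHmult_dim (g := g) _ det); first by move=> x y.
by move=> v; apply: (limg_linfunP (mat_fun_lin _)).
Qed.

Section Projective.
Variables (P : lmodule R) (l : X) (d : cd_E D) (e : R).
Hypotheses (lX0 : in_X0 D l) (hP : lmod_iso (Defs.head P) (simple_L D l)).
Hypotheses (Pe : lmod_iso P (Rmod e)) (ee : e ** e = e).
Hypotheses (de : eps d ** e = e) (ed : e ** eps d = e).

Lemma proj_detects : detects e (simple_L D l).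
Proof. exact: detects_of_head hP Pe ee. Qed.

Lemma JHmult_Delta_star n :
  JHmult (Delta D n) (simple_L D l) = mat_rank (cell_mx e^! (n := n)).
Proof. exact/JHmult_Delta/(detects_star lX0 ed)/proj_detects. Qed.

(** For the other [n], [e] acts on the cell module as 0 by [head_support]. This accounts for the
    order conditions in the sum of (b). *)
Lemma JHmult_Delta_le n :
  JHmult (Delta D n) (simple_L D l) != 0%N -> cell_le d n l.
Proof.
apply: contraR => nl; rewrite (JHmult_Delta n proj_detects).
rewrite (@mat_rankP _ _ _ 0%VS) ?dimv0 // => v; rewrite memv0.
have e0 x : mat_fun (cell_mx e (n := n)) x = 0.
  apply/ffunP => S'; rewrite !ffunE big1 // => S _.
  rewrite [cell_mx _ _ _](_ : _ = 0) ?mulr0 //; apply: contrapT => re.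
  by move/negP: nl; apply; apply: (head_support lX0 hP Pe ee de ed re).
by split=> [/eqP ->|[x ->]]; [exists 0|apply/eqP].
Qed.

(** The embedding of [P] in [R] carries f P onto f R e, the image of a |-> f a e; [t] is the matrix
    of this operator in the cellular basis. *)
Lemma JHmult_proj m f : detects f (simple_L D m) ->
  JHmult P (simple_L D m) =
  (\sum_n mat_rank (cell_mx e^! (n := n)) * mat_rank (cell_mx f (n := n)))%N.
Proof.
move=> det; have [p [i [inji eqi ip gen]]] := Rmod_generator Pe ee.
pose t (j k : {n : X & (cd_M D n * cd_M D n)%type}) : K :=
  cell_coef (tagged j).1 (tagged j).2 (f ** C (tagged k).1 (tagged k).2 ** e).
have tE a : mat_fun t (cell_coords D a) = cell_coords D (f ** a ** e).
  apply/ffunP => j; rewrite !ffunE {2}(cell_expand D a).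
  rewrite amul_sumr amul_suml co_sum; apply: eq_bigr => k _.
  by rewrite ffunE amulZr amulZl coZ.
have [ff _ _] := det.
pose g := to_linear (cell_coords_lin D) \o i : {linear P -> _}.
rewrite (JHmult_dim (g := g) (E := limg (linfun (mat_fun t))) _ det); first last.
- move=> v; rewrite (limg_linfunP (mat_fun_lin t)); split=> [[w ->]|[x ->]].
    have [a ->] := cell_coords_surj w; exists (act a p).
    by rewrite tE /= !eqi ip amulA.
  have [a ->] := gen x; exists (cell_coords D a).
  by rewrite tE /= !eqi ip amulA.
- by move=> x y /cell_coords_inj/inji.
rewrite -[LHS]/(mat_rank t).
rewrite (mat_rank_block_triangular (@cd_lt_irr _ _ _ D d) (@cd_lt_trans _ _ _ D d)).
- apply: eq_bigr => n _; rewrite mulnC -mat_rank_tensor; congr mat_rank.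
  by apply/funext => j; apply/funext => k; apply: (co_two_sided de ed).
- move=> v; have [a ->] := cell_coords_surj v; rewrite !tE.
  by rewrite !amulA ff -amulA ee.
by move=> j k jk; apply: (co_two_sided_lt de ed).
Qed.

End Projective.

End Multiplicities.

(** * Dimension formula and Cartan matrix *)

Theorem theorem3p23 (K : fieldType) (R : algebra K) (X : finType)
  (D : cell_datum R X)
  (P : X -> lmodule R)
  (P_proj : forall nu : X, nu \in X0 D ->
     is_proj_indec_with_head (P nu) (simple_L D nu))
  (epsX : X -> cd_E D)
  (epsX_P : forall nu : X, nu \in X0 D ->
     exists f : R,
       [/\ primitive_idempotent f,
           cd_eps D (epsX nu) ** f = f,
           f ** cd_eps D (epsX nu) = f &
           lmod_iso (P nu) (Rmod f)])
  (lambda mu : X) (lambda_X0 : lambda \in X0 D)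
  (e : R) (e_prim : primitive_idempotent e)
  (eps_e : cd_eps D (epsX lambda) ** e = e)
  (e_eps : e ** cd_eps D (epsX lambda) = e)
  (P_e : lmod_iso (P lambda) (Rmod e)) :
  [/\ JHmult (Delta D mu) (simple_L D lambda) = \dim (Delta_star_mul D mu e),
      mu \in X0 D ->
      JHmult (P lambda) (simple_L D mu) =
      (\sum_(nu : X | cell_le (epsX lambda) nu lambda && cell_le (epsX mu) nu mu)
         JHmult (Delta D nu) (simple_L D lambda) *
         JHmult (Delta D nu) (simple_L D mu))%N &
      cartan_mx D P = (decomposition_mx D)^T *m decomposition_mx D].
Proof.
have inX0 nu : nu \in X0 D -> in_X0 D nu by rewrite inE => /asboolP.
have [_ _ head_lambda] := P_proj lambda lambda_X0.
have [[_ ee] _] := e_prim.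
(* The sum over all [nu] serves both (b) and the matrix identity. *)
have cartan l m : l \in X0 D -> m \in X0 D ->
    JHmult (P l) (simple_L D m) =
    (\sum_nu JHmult (Delta D nu) (simple_L D l) *
       JHmult (Delta D nu) (simple_L D m))%N.
  move=> lX0 mX0; have [_ _ hl] := P_proj l lX0; have [_ _ hm] := P_proj m mX0.
  have [f [[[_ ff] _] df fd Pf]] := epsX_P l lX0.
  have [h [[[_ hh] _] _ _ Ph]] := epsX_P m mX0.
  have det := proj_detects (inX0 m mX0) hm Ph hh.
  rewrite (JHmult_proj Pf ff df fd det); apply: eq_bigr => nu _.
  by rewrite (JHmult_Delta_star (inX0 l lX0) hl Pf ff fd) (JHmult_Delta _ det).
split=> [|mu_X0|].
(* The right action of [e] is the left action of [e^!], so [Delta_star_mul] unfolds to the image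
   measured by [mat_rank]. *)
- by rewrite (JHmult_Delta_star (inX0 _ lambda_X0) head_lambda P_e ee e_eps).
- rewrite cartan // [RHS]big_mkcond; apply: eq_bigr => nu _ /=.
  have [_ _ head_mu] := P_proj mu mu_X0.
  have [f [[[_ ff] _] df fd Pf]] := epsX_P mu mu_X0.
  (* A nonzero product has both factors nonzero, and each gives one of the two order conditions. *)
  case: ifPn => //; apply: contraNeq; rewrite muln_eq0 negb_or => /andP[hl hm].
  rewrite (JHmult_Delta_le (inX0 _ lambda_X0) head_lambda P_e) //.
  exact: (JHmult_Delta_le (inX0 _ mu_X0) head_mu Pf).
apply/matrixP => i j; rewrite !mxE cartan ?enum_valP //.
rewrite (reindex_onto (enum_val : 'I_#|X| -> X) enum_rank) /=; last first.
  by move=> nu _; rewrite enum_rankK.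
by apply: eq_big => [k|k _]; [rewrite enum_valK eqxx|rewrite !mxE].
Qed.
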